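(* Let $m\ge1$ be an integer and $k>0$. Assume that the continuous Cauchy problem $\Delta u+k^2u=f$ in $\Omega$, $u=g_1$ and $\nabla u\cdot\mathbf{n}=g_2$ on $\Gamma_1$, admits a unique solution. Then the LS-WG finite element scheme: find $u_h=\{u_0,u_b,\mathbf{u}_g\}\in W_h$ with $u_b=Q_bg_1$ and $\mathbf{u}_g\cdot\mathbf{n}=Q_ng_2$ on $\Gamma_1$ such that $$a(u_h,v_h)=\sum_{T\in\mathcal{T}_h}(f,\Delta_w v_h+k^2v_0)_T\qquad\text{for all } v_h=\{v_0,v_b,\mathbf{v}_g\}\in W_h^0,$$ possesses a unique solution $u_h\in W_h$.
   Context: Setting. $\Omega\subset\mathbb{R}^d$ ($d=2,3$) is an open bounded polytopal domain with unit outward normal $\mathbf{n}$ on $\partial\Omega$. Its boundary is partitioned into disjoint relatively open subsets $\Gamma_1,\Gamma_2$ with $\partial\Omega=\overline{\Gamma}_1\cup\overline{\Gamma}_2$ and $|\Gamma_1|>0$. The data $f,g_1,g_2$ are sufficiently regular. $(\cdot,\cdot)_T$, $\langle\cdot,\cdot\rangle_{\partial T}$ are $L^2$ inner products. Mesh. $\mathcal{T}_h$ is a shape-regular partition of $\Omega$ into polygons ($d=2$) or polyhedra ($d=3$); $\mathcal{E}_h$ is the set of its edges ($d=2$) or faces ($d=3$), called edges, and $\mathcal{E}_h^0=\mathcal{E}_h\setminus\partial\Omega$ is the set of interior ones. $h_T$ is the diameter of $T$. On $\partial T$, $\mathbf{n}$ is the unit outward normal of $T$. Weak functions. $P_j$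 denotes polynomials of degree at most $j$. $W_m(T)$ is the set of triplets $v=\{v_0,v_b,\mathbf{v}_g\}$ with $v_0\in P_m(T)$ and, on each edge $e\subset\partial T$, $v_b\in P_m(e)$, $\mathbf{v}_g\in[P_{m-1}(e)]^d$; the components $v_b,\mathbf{v}_g$ need not be traces of $v_0,\nabla v_0$. $W_h$ is obtained by patching the spaces $W_m(T)$ so that on each $e\in\mathcal{E}_h^0$ the component $v_b$ and (for a fixed choice of unit normal to $e$) the normal component of $\mathbf{v}_g$ are single-valued. $W_h^0=\{v\in W_h: v_b|_e=0,\ \mathbf{v}_g\cdot\mathbf{n}|_e=0 \text{ for } e\subset\Gamma_1\}$. Discrete weak Laplacian. On each $T$, $\Delta_w v\in P_m(T)$ is the unique polynomial with $$(\Delta_w v,w)_T=(v_0,\Delta w)_T-\langle v_b,\nabla w\cdot\mathbf{n}\rangle_{\partial T}+\langle\mathbf{v}_g\cdot\mathbf{n},w\rangle_{\partial T}\quad\text{for all } w\in P_m(T).$$ Forms. For $u,v\in W_h$, $$s(u,v)=\sum_{T}k^2h_T^{-3}\langle u_0-u_b,v_0-v_b\rangle_{\partial T}+k^2h_T^{-1}\langle(\nabla u_0-\mathbf{u}_g)\cdot\mathbf{n},(\nabla v_0-\mathbf{v}_g)\cdot\mathbf{n}\rangle_{\partial T},$$ $$a(u,v)=\sum_{T}(\Delta_w u+k^2u_0,\Delta_w v+k^2v_0)_T+s(u,v).$$ Projections. $Q_b$ and $Q_n$ are the local $L^2$ projections on each edge $e$ onto $P_m(e)$ and $P_{m-1}(e)$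 respectively.
   Formalization: Uniqueness is stated for u_0, u_b and the normal component of u_g only: the tangential part of u_g enters neither the scheme nor the boundary conditions, so adding a nonzero tangential vector to u_g on an edge gives another solution and literal uniqueness in W_h fails. *)

(* Defs.v *)
From HB Require Import structures.
From mathcomp Require Import all_boot all_order all_algebra.
(* Loaded before the analysis library, whose notations and structure names
   (e.g. [Measure]) must take precedence over those of mpoly. *)
From mathcomp Require Import -(notations) mpoly.
From mathcomp Require Import all_classical all_reals all_analysis.

Set Implicit Arguments.
Unset Strict Implicit.
Unset Printing Implicit Defensive.

Import Order.TTheory GRing.Theory Num.Theory numFieldNormedType.Exports.
Local Open Scope classical_set_scope.
Local Open Scope ring_scope.

Section lebesgue_n.
Context (R : realType).
Local Notation mR := (measurableTypeR R).

Definition tcons n (p : mR * n.-tuple mR) : n.+1.-tuple mR :=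
  [tuple of p.1 :: p.2].

(* The n-fold product of the Lebesgue measure, on n-tuples. *)
Fixpoint leb (n : nat) : set (n.-tuple mR) -> \bar R :=
  match n with
  | 0 => \d_ ([tuple] : 0.-tuple mR)
  | n'.+1 => pushforward (@lebesgue_measure R \x @leb n')%E (@tcons n')
  end.

Lemma measurable_tcons n : measurable_fun [set: mR * n.-tuple mR] (@tcons n).
Proof. by apply: measurable_cons. Qed.

Definition tuncons n (t : n.+1.-tuple mR) : mR * n.-tuple mR :=
  (thead t, [tuple of behead t]).

Lemma measurable_tuncons n : measurable_fun [set: n.+1.-tuple mR] (@tuncons n).
Proof.
by apply/measurable_fun_pairP; split; [exact: measurable_tnth|exact: measurable_behead].
Qed.

Lemma tconsK n : cancel (@tcons n) (@tuncons n).
Proof.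
by move=> [x t]; congr pair; apply: val_inj.
Qed.

Lemma leb_sigma_finite_measure n :
  exists mu : {sigma_finite_measure set (n.-tuple mR) -> \bar R},
    @leb n = mu :> (set _ -> \bar R).
Proof.
elim: n => [|n [mu IH]].
  by exists (\d_ ([tuple] : 0.-tuple mR)).
rewrite /= IH.
pose pm : {measure set (mR * n.-tuple mR)%type -> \bar R} :=
  (@lebesgue_measure R \x mu)%E.
have pmT : sigma_finite setT pm.
  have /sigma_finiteP[F [TF ndF Foo]] := sigma_finiteT (@lebesgue_measure R).
  have /sigma_finiteP[G [TG ndG Goo]] := sigma_finiteT mu.
  exists (fun i => F i `*` G i).
    rewrite -setXTT TF TG predeqE => -[x y]; split.
      move=> [/= [i _ Fix] [j _ Gjy]]; exists (maxn i j) => //; split.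
      - by move: x Fix; exact/subsetPset/ndF/leq_maxl.
      - by move: y Gjy; exact/subsetPset/ndG/leq_maxr.
    by move=> [i _ []/= ? ?]; split; exists i.
  move=> i; have [mF Fi] := Foo i; have [mG Gi] := Goo i.
  split; first exact: measurableX.
  by rewrite /pm/= product_measure1E// lte_mul_pinfty// ge0_fin_numE.
pose nu : {measure set (n.+1.-tuple mR) -> \bar R} :=
  measure_function_pushforward__canonical__measure_function_Measure
    pm (@measurable_tcons n).
have nuT : sigma_finite setT nu.
  have [F TF Foo] := pmT.
  exists (fun i => @tuncons n @^-1` F i).
    by rewrite -preimage_bigcup -TF.
  move=> i; have [mF Fi] := Foo i; split.
    by rewrite -[X in measurable X]setTI; exact: measurable_tuncons.
  rewrite /nu/= /pushforward -comp_preimage.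
  rewrite (_ : @tuncons n \o @tcons n = id) ?preimage_id//.
  by apply/funext => x /=; rewrite tconsK.
pose H := Measure_isSigmaFinite.Build _ _ _ _ nuT.
pose nu' := HB.pack_for {sigma_finite_measure set (n.+1.-tuple mR) -> \bar R}
  (Measure.sort nu) H.
by exists nu'.
Qed.

Let leb0 n : leb (@set0 (n.-tuple mR)) = 0%E.
Proof. by have [mu ->] := leb_sigma_finite_measure n. Qed.

Let leb_ge0 n (A : set (n.-tuple mR)) : (0 <= leb A)%E.
Proof. by have [mu ->] := leb_sigma_finite_measure n. Qed.

Let leb_semi_sigma_additive n : semi_sigma_additive (@leb n).
Proof.
have [mu ->] := leb_sigma_finite_measure n.
exact: measure_semi_sigma_additive.
Qed.

HB.instance Definition _ n := isMeasure.Build _ _ _ (@leb n)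
  (@leb0 n) (@leb_ge0 n) (@leb_semi_sigma_additive n).

Let leb_sigma_finite n : sigma_finite setT (@leb n).
Proof.
have [mu ->] := leb_sigma_finite_measure n; exact: sigma_finiteT.
Qed.

HB.instance Definition _ n := Measure_isSigmaFinite.Build _ _ _ (@leb n)
  (@leb_sigma_finite n).

End lebesgue_n.

Arguments leb R n : clear implicits.

Section euclidean.
Context (R : realType).

Definition tvec n (t : n.-tuple (measurableTypeR R)) : 'rV[R]_n :=
  \row_i tnth t i.

Definition vol n (D : set 'rV[R]_n) : \bar R := leb R n [set t | D (tvec t)].

Definition integ n (D : set 'rV[R]_n) (F : 'rV[R]_n -> R) : R :=
  \int[leb R n]_(t in [set t | D (tvec t)]) F (tvec t).

Definition L2 n (D : set 'rV[R]_n) (F : 'rV[R]_n -> R) : Prop :=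
  measurable_fun [set t : n.-tuple (measurableTypeR R) | D (tvec t)]
    (fun t => F (tvec t)) /\
  (\int[leb R n]_(t in [set t | D (tvec t)]) (F (tvec t) ^+ 2)%:E < +oo)%E.

Definition dot n (x y : 'rV[R]_n) : R := \sum_i x 0 i * y 0 i.

(* The library norm on 'rV[R]_n is the sup norm; metric quantities below use
   the Euclidean one. *)
Definition enorm n (x : 'rV[R]_n) : R := Num.sqrt (dot x x).

Definition diam n (S : set 'rV[R]_n) : R :=
  sup [set r | exists x y, [/\ S x, S y & r = enorm (x - y)]].

Definition bdry n (S : set 'rV[R]_n) : set 'rV[R]_n := closure S `\` S°.

(* Regular open sets whose boundary lies in finitely many hyperplanes; this
   allows non-convex and non-simply connected polytopes but no slits. *)
Record polytopal n (D : set 'rV[R]_n) : Prop := {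
  polytopal_open : open D ;
  polytopal_nonempty : D !=set0 ;
  polytopal_connected : connected D ;
  polytopal_bounded : exists r, forall x, D x -> enorm x <= r ;
  polytopal_regular : (closure D)° = D ;
  polytopal_faces : exists s : seq ('rV[R]_n * R),
    (forall p, p \in s -> p.1 != 0) /\
    (forall x, bdry D x -> exists2 p, p \in s & dot p.1 x = p.2) }.

(* [nu] is the unit outward normal of [D] at [x], [x] being a point near which
   [D] is a half-space. *)
Definition outward_normal n (D : set 'rV[R]_n) (x nu : 'rV[R]_n) : Prop :=
  dot nu nu = 1 /\
  exists2 r, 0 < r &
    forall y, enorm (y - x) < r -> (D y <-> dot (y - x) nu < 0).

(* Isometric charts of hyperplanes, which carry the surface measure. *)
Definition chart d (b : 'rV[R]_d) (A : 'M[R]_(d.-1, d)) (y : 'rV[R]_d.-1) :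
  'rV[R]_d := b + y *m A.

Definition orthoframe d (A : 'M[R]_(d.-1, d)) (nu : 'rV[R]_d) : Prop :=
  [/\ A *m A^T = 1%:M, nu *m A^T = 0 & dot nu nu = 1].

(* For [G] contained in finitely many hyperplanes. *)
Definition pos_surface d (G : set 'rV[R]_d) : Prop :=
  exists b A nu, orthoframe A nu /\ (0 < vol (chart b A @^-1` G))%E.

Definition L2_surface d (G : set 'rV[R]_d) (g : 'rV[R]_d -> R) : Prop :=
  forall b A nu, orthoframe A nu ->
    L2 (chart b A @^-1` G) (fun y => g (chart b A y)).

Definition rel_open n (B G : set 'rV[R]_n) : Prop :=
  exists2 U, open U & G = B `&` U.

Record boundary_partition n (Omega G1 G2 : set 'rV[R]_n) : Prop := {
  bpart_open1 : rel_open (bdry Omega) G1 ;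
  bpart_open2 : rel_open (bdry Omega) G2 ;
  bpart_disj : G1 `&` G2 = set0 ;
  bpart_cover : bdry Omega = closure G1 `|` closure G2 }.

End euclidean.

Section cauchy.
Context (R : realType) (d : nat).
Implicit Types (Omega G : set 'rV[R]_d) (u g f phi : 'rV[R]_d -> R).

Definition pderiv (i : 'I_d) phi : 'rV[R]_d -> R :=
  fun x => 'D_(delta_mx 0 i) phi x.

Definition smooth phi : Prop := forall s : seq 'I_d,
  continuous (foldr pderiv phi s) /\
  forall x i, derivable (foldr pderiv phi s) x (delta_mx 0 i).

Definition test_in (K : set 'rV[R]_d) phi : Prop :=
  [/\ smooth phi, compact K & forall x, ~ K x -> phi x = 0].

Definition weak_pderiv Omega u (i : 'I_d) g : Prop :=
  forall K phi, test_in K phi -> K `<=` Omega ->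
    integ Omega (fun x => u x * pderiv i phi x) =
    - integ Omega (fun x => g x * phi x).

(* Test functions whose support meets the boundary only inside [G] and inside
   one flat piece of it, charted by [chart b A] and with outward normal [nu].
   Points where the boundary is not flat have no surface measure. *)
Definition boundary_test Omega G (b : 'rV[R]_d) (A : 'M[R]_(d.-1, d))
    (nu : 'rV[R]_d) phi : Prop :=
  orthoframe A nu /\
  exists2 K, test_in K phi &
    forall x, K x -> bdry Omega x ->
      [/\ G x, exists y, x = chart b A y & outward_normal Omega x nu].

(* Trace and normal trace on [G] are defined through Green's formula. *)
Definition has_trace Omega G u (Du : 'I_d -> 'rV[R]_d -> R) g : Prop :=
  forall b A nu phi, boundary_test Omega G b A nu phi -> forall i,
    integ Omega (fun x => u x * pderiv i phi x + Du i x * phi x) =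
    integ (chart b A @^-1` G)
      (fun y => g (chart b A y) * phi (chart b A y) * nu 0 i).

Definition has_normal_trace Omega G (Du : 'I_d -> 'rV[R]_d -> R)
    (divDu g : 'rV[R]_d -> R) : Prop :=
  forall b A nu phi, boundary_test Omega G b A nu phi ->
    integ Omega
      (fun x => (\sum_i Du i x * pderiv i phi x) + divDu x * phi x) =
    integ (chart b A @^-1` G) (fun y => g (chart b A y) * phi (chart b A y)).

(* Strong solutions: [u] in H^2 with weak gradient [Du] and weak Hessian [D2u],
   the equation holding almost everywhere. *)
Definition cauchy_solution Omega G (k : R) f g1 g2 u : Prop :=
  exists (Du : 'I_d -> 'rV[R]_d -> R) (D2u : 'I_d -> 'I_d -> 'rV[R]_d -> R),
    let lapu := fun x => \sum_i D2u i i x in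
    [/\ [/\ L2 Omega u, forall i, L2 Omega (Du i) &
            forall i j, L2 Omega (D2u i j)],
        (forall i, weak_pderiv Omega u i (Du i)) /\
        (forall i j, weak_pderiv Omega (Du i) j (D2u i j)),
        {ae leb R d, forall t, Omega (tvec t) ->
           lapu (tvec t) + k ^+ 2 * u (tvec t) = f (tvec t)},
        has_trace Omega G u Du g1 &
        has_normal_trace Omega G Du lapu g2].

Definition cauchy_unique_solution Omega G (k : R) f g1 g2 : Prop :=
  exists2 u, cauchy_solution Omega G k f g1 g2 u &
    forall u', cauchy_solution Omega G k f g1 g2 u' ->
      {ae leb R d, forall t, Omega (tvec t) -> u' (tvec t) = u (tvec t)}.

End cauchy.

Section mesh.
Context (R : realType) (d : nat).

Record facet := Facet {
  f_org : 'rV[R]_d ;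
  f_frame : 'M[R]_(d.-1, d) ;
  f_dom : set 'rV[R]_d.-1 ;
  f_nor : 'rV[R]_d }.

Definition f_chart (e : facet) := chart (f_org e) (f_frame e).
Definition f_set (e : facet) : set 'rV[R]_d := f_chart e @` f_dom e.

(* Cells and edges are open, resp. relatively open. A flat side of a cell may
   be subdivided into several edges (hanging nodes). *)
Record mesh (Omega : set 'rV[R]_d) := Mesh {
  elt : finType ;
  edge : finType ;
  cell : elt -> set 'rV[R]_d ;
  fac : edge -> facet ;
  mesh_cell : forall T, polytopal (cell T) ;
  mesh_disj : forall T T', T != T' -> cell T `&` cell T' = set0 ;
  mesh_cover : closure Omega = \bigcup_T closure (cell T) ;
  mesh_facet : forall e,
    polytopal (f_dom (fac e)) /\ orthoframe (f_frame (fac e)) (f_nor (fac e)) ;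
  mesh_edge_disj : forall e e', e != e' -> f_set (fac e) `&` f_set (fac e') = set0 ;
  mesh_edge_cell : forall e, exists T, f_set (fac e) `<=` bdry (cell T) ;
  mesh_bdry : forall T,
    bdry (cell T) =
    \bigcup_(e in [set e | f_set (fac e) `<=` bdry (cell T)])
      closure (f_set (fac e)) ;
  mesh_side : forall T e, f_set (fac e) `<=` bdry (cell T) ->
    (forall x, f_set (fac e) x -> outward_normal (cell T) x (f_nor (fac e))) \/
    (forall x, f_set (fac e) x -> outward_normal (cell T) x (- f_nor (fac e))) }.

Context (Omega : set 'rV[R]_d) (M : mesh Omega).
Implicit Types (T : elt M) (e : edge M).

Definition eset e : set 'rV[R]_d := f_set (fac e).

Definition edge_of T e : bool := `[< eset e `<=` bdry (cell T) >].

Definition interior_edge e : Prop := ~ (eset e `<=` bdry Omega).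

Definition cell_normal T e : 'rV[R]_d :=
  if `[< forall x, eset e x -> outward_normal (cell T) x (f_nor (fac e)) >]
  then f_nor (fac e) else - f_nor (fac e).

Definition hull n (p : 'I_n -> 'rV[R]_d) : set 'rV[R]_d :=
  [set x | exists c : 'I_n -> R,
    [/\ forall i, 0 <= c i, \sum_i c i = 1 & x = \sum_i c i *: p i]].

(* The usual weak Galerkin notion of shape regularity for polytopal meshes
   (Wang and Ye): volumes and edges comparable to the diameters, interior
   pyramids over the edges, circumscribed shape-regular simplices with finite
   overlap. The single constant [rho] stands for all lower bounds, and the
   acute angle condition is a lower bound on a cosine. *)
Record shape_regular (rho gamma : R) (N : nat) : Prop := {
  sreg_rho : 0 < rho ;
  sreg_gamma : 0 < gamma ;
  sreg_vol : forall T, ((rho * diam (cell T) ^+ d)%:E <= vol (cell T))%E ;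
  sreg_edge_vol : forall e,
    ((rho * diam (eset e) ^+ d.-1)%:E <= vol (f_dom (fac e)))%E ;
  sreg_edge_diam : forall T e, edge_of T e ->
    rho * diam (cell T) <= diam (eset e) ;
  sreg_pyramid : forall T e, edge_of T e ->
    exists2 a, cell T a & forall x, eset e x ->
      [/\ forall s, 0 <= s < 1 -> cell T ((1 - s) *: a + s *: x),
          rho * diam (cell T) <= dot (x - a) (cell_normal T e) &
          rho * enorm (x - a) <= dot (x - a) (cell_normal T e)] ;
  sreg_simplex : exists p : elt M -> 'I_d.+1 -> 'rV[R]_d,
    forall T, [/\ cell T `<=` hull (p T),
      diam (hull (p T)) <= gamma * diam (cell T),
      exists c, forall x, enorm (x - c) < rho * diam (hull (p T)) ->
        hull (p T) x &
      (#|[pred T' | `[< hull (p T) `&` hull (p T') !=set0 >]]| <= N)%N] }.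

End mesh.

Section scheme.
Context (R : realType) (d : nat) (Omega : set 'rV[R]_d) (M : mesh Omega).
Implicit Types (T : elt M) (e : edge M).

Definition Pol n (j : nat) : set (mpoly n R) :=
  [set p | (msize p <= j.+1)%N].

Definition ev n (p : mpoly n R) (x : 'rV[R]_n) : R := meval (fun i => x 0 i) p.

Definition laplacian (p : mpoly d R) : mpoly d R :=
  \sum_i mderiv i (mderiv i p).

Definition nderiv (nu : 'rV[R]_d) (p : mpoly d R) : mpoly d R :=
  \sum_i nu 0 i *: mderiv i p.

(* Polynomials on an edge are written in the coordinates of its chart; the
   values of [wb T e] and [wg T e] are irrelevant unless [e] is an edge of
   [T]. *)
Record wfun := WFun {
  w0 : elt M -> mpoly d R ;
  wb : elt M -> edge M -> mpoly d.-1 R ;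
  wg : elt M -> edge M -> 'I_d -> mpoly d.-1 R }.

Definition ncomp (nu : 'rV[R]_d) (q : 'I_d -> mpoly d.-1 R) : mpoly d.-1 R :=
  \sum_i nu 0 i *: q i.

Definition in_Wloc (m : nat) (v : wfun) T : Prop :=
  Pol m (w0 v T) /\
  forall e, edge_of T e ->
    Pol m (wb v T e) /\ forall i, Pol m.-1 (wg v T e i).

Definition in_W (m : nat) (v : wfun) : Prop :=
  (forall T, in_Wloc m v T) /\
  forall e, interior_edge e -> forall T T', edge_of T e -> edge_of T' e ->
    wb v T e = wb v T' e /\
    ncomp (f_nor (fac e)) (wg v T e) = ncomp (f_nor (fac e)) (wg v T' e).

Definition in_W0 (m : nat) (G1 : set 'rV[R]_d) (v : wfun) : Prop :=
  in_W m v /\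
  forall T e, edge_of T e -> eset e `<=` G1 ->
    wb v T e = 0 /\ ncomp (cell_normal T e) (wg v T e) = 0.

Definition ipT T (F G : 'rV[R]_d -> R) : R :=
  integ (cell T) (fun x => F x * G x).

(* Functions on the boundary of a cell are given edgewise, in charts. *)
Definition ipdT T (F G : edge M -> 'rV[R]_d.-1 -> R) : R :=
  \sum_(e | edge_of T e) integ (f_dom (fac e)) (fun y => F e y * G e y).

Definition tr (p : mpoly d R) e : 'rV[R]_d.-1 -> R :=
  fun y => ev p (f_chart (fac e) y).

Definition ntr T (p : mpoly d R) e : 'rV[R]_d.-1 -> R :=
  tr (nderiv (cell_normal T e) p) e.

Definition vbt (v : wfun) T e : 'rV[R]_d.-1 -> R := ev (wb v T e).

Definition vgt (v : wfun) T e : 'rV[R]_d.-1 -> R :=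
  ev (ncomp (cell_normal T e) (wg v T e)).

Definition is_weak_laplacian (m : nat) (v : wfun) T (q : mpoly d R) : Prop :=
  Pol m q /\ forall w, Pol m w ->
    ipT T (ev q) (ev w) =
      ipT T (ev (w0 v T)) (ev (laplacian w))
      - ipdT T (vbt v T) (ntr T w)
      + ipdT T (vgt v T) (tr w).

Definition weak_laplacian (m : nat) (v : wfun) T : mpoly d R :=
  xget 0 [set q | is_weak_laplacian m v T q].

Definition stab (k : R) (u v : wfun) : R :=
  \sum_T (k ^+ 2 * diam (cell T) ^- 3 *
     ipdT T (fun e y => tr (w0 u T) e y - vbt u T e y)
            (fun e y => tr (w0 v T) e y - vbt v T e y)
   + k ^+ 2 * (diam (cell T))^-1 *
     ipdT T (fun e y => ntr T (w0 u T) e y - vgt u T e y)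
            (fun e y => ntr T (w0 v T) e y - vgt v T e y)).

Definition wres (m : nat) (k : R) (v : wfun) T : 'rV[R]_d -> R :=
  fun x => ev (weak_laplacian m v T) x + k ^+ 2 * ev (w0 v T) x.

Definition form (m : nat) (k : R) (u v : wfun) : R :=
  \sum_T ipT T (wres m k u T) (wres m k v T) + stab k u v.

Definition is_edge_proj (j : nat) e (g : 'rV[R]_d -> R) (q : mpoly d.-1 R) :
    Prop :=
  Pol j q /\ forall w, Pol j w ->
    integ (f_dom (fac e)) (fun y => ev q y * ev w y) =
    integ (f_dom (fac e)) (fun y => g (f_chart (fac e) y) * ev w y).

Definition edge_proj (j : nat) e (g : 'rV[R]_d -> R) : mpoly d.-1 R :=
  xget 0 [set q | is_edge_proj j e g q].

Definition Qb (m : nat) := edge_proj m.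
Definition Qn (m : nat) := edge_proj m.-1.

Definition lswg_solution (m : nat) (k : R) (G1 : set 'rV[R]_d)
    (f g1 g2 : 'rV[R]_d -> R) (u : wfun) : Prop :=
  [/\ in_W m u,
      forall T e, edge_of T e -> eset e `<=` G1 ->
        wb u T e = Qb m e g1 /\
        ncomp (cell_normal T e) (wg u T e) = Qn m e g2 &
      forall v, in_W0 m G1 v ->
        form m k u v = \sum_T ipT T f (wres m k v T)].

(* Only the normal component of the third entry of a weak function enters the
   weak Laplacian, the forms and the boundary conditions, so that weak
   functions are compared through it. *)
Definition weq (u v : wfun) : Prop :=
  forall T, w0 u T = w0 v T /\
    forall e, edge_of T e ->
      wb u T e = wb v T e /\
      ncomp (f_nor (fac e)) (wg u T e) = ncomp (f_nor (fac e)) (wg v T e).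

End scheme.

(* Main.v *)
(** The scheme is a square linear problem up to the tangential parts of the third
    components, so it is enough that its form is definite.  If [a(e, e) = 0], the
    stabilizer makes [e_b] and [e_g . n] the traces of [e_0] and of its normal
    derivative, and Green's formula on each cell gives
    [Delta_w e = Delta e_0]; hence [Delta e_0 + k^2 e_0 = 0].  Since [e_0] is a
    polynomial and [k <> 0], comparing degrees forces [e_0 = 0] cell by cell.

    Green's formula comes from slicing a cell by the lines in a coordinate
    direction: almost every line meets the boundary at finitely many points, each
    inside a single facet transversal to it, and on such a line the indicator of
    the cell is a signed sum of indicators of half-lines ending at these points.
    Integrating over the lines and changing variables from the projection of each
    facet to its chart, with determinant [|n_i|], yields the boundary terms. *)

Require Import Defs.
From HB Require Import structures.
From mathcomp Require Import all_boot all_order all_algebra.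
From mathcomp Require Import -(notations) mpoly.
From mathcomp Require Import all_classical all_reals all_analysis.
From mathcomp Require Import measurable_realfun ring lra.

Set Implicit Arguments.
Unset Strict Implicit.
Unset Printing Implicit Defensive.

Import Order.TTheory GRing.Theory Num.Theory numFieldNormedType.Exports.
Local Open Scope classical_set_scope.
Local Open Scope ring_scope.

(** * Slices of the product Lebesgue measure *)

Section tuple_measure.
Context (R : realType).
Local Notation mR := (measurableTypeR R).
Local Notation lam := (@lebesgue_measure R).

(** A cell is described by [outward_normal] only near points inside its facets, and it may be
    non-convex or have holes. No triangulation is at hand, so Green's formula has to come from this
    local information. Slicing by lines asks for nothing more, because a locally constant function
    of one real variable is constant.

    Existence has its own obstacle: weak functions form a bare record, and the scheme sees them only
    up to [weq]. In place of a basis and a dimension count, a finite family spanning modulo [weq] is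
    used. Its Gram system may be singular, but it is solvable as soon as the right-hand side kills
    the kernel, and definiteness shows that a kernel vector represents the zero function. The same
    argument yields the weak Laplacian on a cell. Inhomogeneous Cauchy data are moved to the
    right-hand side by a lift carried by the edges inside [Gamma1]. *)

Lemma lebesgue_measure_affine (a b : R) (A : set mR) : a != 0 -> measurable A ->
  lam ((fun x : mR => a * x + b : mR) @^-1` A) = (`|a|^-1%:E * lam A)%E.
Proof.
move=> a0 mA.
have mf : measurable_fun [set: mR] (fun x : mR => a * x + b : mR).
  by apply: measurable_funD => //; apply: measurable_funM.
pose nu : {measure set mR -> \bar R} :=
  measure_function_pushforward__canonical__measure_function_Measure lam mf.
have aa : 0 <= `|a| by [].
pose mu := mscale (NngNum aa) nu.
(* The image of Lebesgue measure, rescaled by [|a|], gives each interval []u, v]] its length, and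
   uniqueness does the rest. For negative [a] the preimage is closed at the other end. *)
have key : lam A = mu A.
  apply: lebesgue_measure_unique => // X [[u v] _ <-] /=.
  rewrite /mu /mscale /= /pushforward.
  have [a_gt0|a_le0] := ltP 0 a.
    have -> : (fun x : mR => a * x + b) @^-1` `]u, v]%classic =
        `](u - b) / a, (v - b) / a]%classic.
      apply/seteqP; split => x /=;
      by rewrite !in_itv/= ltr_pdivrMr// ler_pdivlMr// mulrC; lra.
    rewrite !lebesgue_measure_itv /= !lte_fin ltr_pM2r ?invr_gt0// ltrD2r.
    case: ifP => uv; last by rewrite mule0.
    rewrite -!EFinB -EFinM; congr EFin; rewrite gtr0_norm//.
    by field.
  have a_lt0 : a < 0 by rewrite lt_neqAle a0.
  have -> : (fun x : mR => a * x + b) @^-1` `]u, v]%classic =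
      `[(v - b) / a, (u - b) / a[%classic.
    apply/seteqP; split => x /=;
    by rewrite !in_itv/= ltr_ndivlMr// ler_ndivrMr// mulrC; lra.
  rewrite !lebesgue_measure_itv /= !lte_fin ltr_nM2r ?invr_lt0// ltrD2r.
  case: ifP => uv; last by rewrite mule0.
  rewrite -!EFinB -EFinM; congr EFin; rewrite ltr0_norm//.
  by field.
rewrite key /mu /mscale /= /pushforward muleA -EFinM mulVf ?mul1e//.
by rewrite normr_eq0.
Qed.

Definition vtup n (v : 'rV[R]_n) : n.-tuple mR := [tuple v 0 i | i < n].

Lemma vtupK n : cancel (@vtup n) (@tvec R n).
Proof. by move=> v; apply/rowP => i; rewrite !mxE tnth_mktuple. Qed.

Lemma tvecK n : cancel (@tvec R n) (@vtup n).
Proof. by move=> t; apply: eq_from_tnth => i; rewrite tnth_mktuple mxE. Qed.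

(** [leb] peels off the first coordinate only. Inserting a coordinate at any position [i] makes [x]
    in [tins i (x, z)] run along the line in direction [i] over [z]. *)
Definition tins n (i : 'I_n.+1) (xz : mR * n.-tuple mR) : n.+1.-tuple mR :=
  [tuple if unlift i j is Some k then tnth xz.2 k else xz.1 | j < n.+1].

Definition tdel n (i : 'I_n.+1) (t : n.+1.-tuple mR) : mR * n.-tuple mR :=
  (tnth t i, [tuple tnth t (lift i k) | k < n]).

Lemma tinsE n (i : 'I_n.+1) xz : tnth (tins i xz) i = xz.1.
Proof. by rewrite tnth_mktuple unlift_none. Qed.

Lemma tins_lift n (i : 'I_n.+1) xz k : tnth (tins i xz) (lift i k) = tnth xz.2 k.
Proof. by rewrite tnth_mktuple liftK. Qed.

Lemma tinsK n (i : 'I_n.+1) : cancel (tins i) (tdel i).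
Proof.
move=> [x z]; rewrite /tdel tinsE; congr pair => /=.
by apply: eq_from_tnth => k; rewrite tnth_mktuple tins_lift.
Qed.

Lemma measurable_tins n (i : 'I_n.+1) : measurable_fun setT (@tins n i).
Proof.
apply/measurable_fun_tnthP => j.
have -> : @tnth n.+1 mR ^~ j \o @tins n i =
    fun xz => if unlift i j is Some k then tnth xz.2 k else xz.1.
  by apply/funext => xz /=; rewrite tnth_mktuple.
case: unliftP => [k _|_]; last exact: measurable_fst.
exact: (measurableT_comp (@measurable_tnth _ mR n k)).
Qed.

Lemma measurable_tdel n (i : 'I_n.+1) : measurable_fun setT (@tdel n i).
Proof.
apply/measurable_fun_pairP; split; first exact: measurable_tnth.
apply/measurable_fun_tnthP => k.
rewrite [X in measurable_fun _ X](_ : _ = fun t => tnth t (lift i k)); last first.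
  by apply/funext => t /=; rewrite tnth_mktuple.
exact: measurable_tnth.
Qed.

Lemma tins0 n : @tins n ord0 = @tcons R n.
Proof.
apply/funext => -[x z]; apply: eq_from_tnth => j; rewrite tnth_mktuple.
by case: unliftP => [k ->|->] /=; rewrite ?tnthS// /tnth/=.
Qed.

Lemma tins_lift_tcons n (j : 'I_n.+1) x y z :
  tins (lift ord0 j) (x, tcons (y, z)) = tcons (y, tins j (x, z)).
Proof.
apply: eq_from_tnth => k; rewrite tnth_mktuple /=.
case: (unliftP ord0 k) => [k' ->|->].
  rewrite tnthS tnth_mktuple.
  case: (unliftP j k') => [l ->|->]; last by rewrite unlift_none.
  have -> : lift ord0 (lift j l) = lift (lift ord0 j) (lift ord0 l).
    by apply/val_inj; rewrite /= /bump /= !add1n ltnS; case: (j <= l)%N.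
  by rewrite liftK tnthS.
case: unliftP => [l /(congr1 val)/=|/(congr1 val)//].
rewrite /bump /= add1n; have [//|_] := ltnP j l; rewrite add0n => l0.
by rewrite (_ : l = ord0)//; apply/val_inj.
Qed.

Lemma measurable_tins_slice n (i : 'I_n.+1) S x : measurable S ->
  measurable [set z : n.-tuple mR | S (tins i (x, z))].
Proof.
move=> mS; rewrite -[X in measurable X]setTI.
have mx : measurable_fun setT (fun z : n.-tuple mR => tins i (x, z)).
  by apply: measurableT_comp; [exact: measurable_tins|exact: pair1_measurable].
exact: mx.
Qed.

Lemma measurable_tins_preimage n (i : 'I_n.+1) S : measurable S ->
  measurable (@tins n i @^-1` S).
Proof. by move=> mS; rewrite -[X in measurable X]setTI; exact: measurable_tins. Qed.

(** Induction on the dimension. For [i] other than 0, coordinate 0 is peeled off by definition, the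
    induction hypothesis slices what remains, and Tonelli's theorem swaps the two outer
    integrals. *)
Lemma leb_tins n (i : 'I_n.+1) (S : set (n.+1.-tuple mR)) : measurable S ->
  leb R n.+1 S = (lam \x leb R n)%E (@tins n i @^-1` S).
Proof.
elim: n i S => [|n IH] i S mS.
  by rewrite (ord1 i) tins0.
case: (unliftP ord0 i) => [j ->|->]; last by rewrite tins0.
pose A : set ((mR * mR) * n.-tuple mR) :=
  [set p | S (tcons (p.1.1, tins j (p.1.2, p.2)))].
have mA : measurable A.
  rewrite -[A]setTI.
  suff mf : measurable_fun setT (fun p : (mR * mR) * n.-tuple mR =>
      tcons (p.1.1, tins j (p.1.2, p.2))) by exact: mf.
  apply: measurableT_comp; first exact: measurable_tcons.
  apply: measurable_fun_pair; first exact: measurableT_comp.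
  apply: (measurableT_comp (measurable_tins j)).
  by apply: measurable_fun_pair => //; exact: measurableT_comp.
transitivity (\int[lam]_y \int[lam]_x leb R n (xsection A (y, x)))%E.
  rewrite /= /pushforward {1}/product_measure1; apply: eq_integral => y _ /=.
  have mSy : measurable [set t : n.+1.-tuple mR | S (tcons (y, t))].
    by have := measurable_tins_slice ord0 y mS; rewrite tins0.
  have -> : xsection (@tcons R n.+1 @^-1` S) y = [set t | S (tcons (y, t))].
    by apply/seteqP; split => t /=; rewrite /xsection /= inE.
  by rewrite [LHS](IH j).
etransitivity.
  apply: (fubini_tonelli (fun p : mR * mR => leb R n (xsection A p))).
  - exact: measurable_fun_xsection.
  - by move=> p; exact: measure_ge0.
rewrite /product_measure1; apply: eq_integral => x _ /=.
rewrite /pushforward /product_measure1; apply: eq_integral => y _ /=.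
congr (leb R n _); apply/seteqP; split => z; rewrite /xsection /= !inE /A /=.
  by rewrite !inE /= tins_lift_tcons.
by rewrite !inE /= tins_lift_tcons.
Qed.

End tuple_measure.

(** The image of [mu] under [phi] is [c] times [nu], which settles nonnegative functions;
    integrability then allows the positive and negative parts to be subtracted. *)
Lemma integral_transfer d1 d2 (X : measurableType d1) (Y : measurableType d2)
    (R : realType) (mu : {measure set X -> \bar R})
    (nu : {measure set Y -> \bar R}) (phi : X -> Y) (c : R) (f : Y -> \bar R) :
  measurable_fun setT phi -> 0 <= c ->
  (forall S, measurable S -> mu (phi @^-1` S) = (c%:E * nu S)%E) ->
  nu.-integrable setT f ->
  mu.-integrable setT (f \o phi) /\
  (\int[mu]_x f (phi x) = c%:E * \int[nu]_y f y)%E.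
Proof.
move=> mphi c0 muE intf; have /integrableP[mf fi] := intf.
pose mu' := measure_function_pushforward__canonical__measure_function_Measure
  mu mphi.
have ge0E (g : Y -> \bar R) : measurable_fun setT g -> (forall y, 0 <= g y)%E ->
    (\int[mu]_x g (phi x) = c%:E * \int[nu]_y g y)%E.
  move=> mg g0.
  have -> : (\int[mu]_x g (phi x) = \int[mu']_y g y)%E.
    rewrite (ge0_integral_pushforward mphi)//.
  rewrite -(ge0_integral_mscale nu measurableT (NngNum c0))//.
  by apply: eq_measure_integral => S mS _; rewrite /mu' /= /pushforward muE.
split.
  apply/integrableP; split; first exact: measurableT_comp.
  rewrite (ge0E (fun y => `|f y|%E)) //; last exact: measurableT_comp.
  by apply: lte_mul_pinfty; rewrite ?lee_fin.
rewrite [LHS]integralE (_ : \int[nu]_y f y =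
  \int[nu]_y f^\+ y - \int[nu]_y f^\- y)%E; last by rewrite {1}integralE.
have := ge0E f^\+%E (measurable_funepos mf) (fun y => funepos_ge0 f y).
rewrite [X in X = _ -> _](_ : _ = \int[mu]_x (fun x => f (phi x))^\+ x)%E; last first.
  by apply: eq_integral => x _; rewrite !funeposE.
move=> ->.
have := ge0E f^\-%E (measurable_funeneg mf) (fun y => funeneg_ge0 f y).
rewrite [X in X = _ -> _](_ : _ = \int[mu]_x (fun x => f (phi x))^\- x)%E; last first.
  by apply: eq_integral => x _; rewrite !funenegE.
move=> ->; rewrite [RHS]muleBr//.
by apply: fin_num_adde_defr; exact: integrable_pos_fin_num.
Qed.

Section tuple_measure2.
Context (R : realType).
Local Notation mR := (measurableTypeR R).
Local Notation lam := (@lebesgue_measure R).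

Lemma leb_tins_slice n (i : 'I_n.+1) (S : set (n.+1.-tuple mR)) : measurable S ->
  leb R n.+1 S = (\int[leb R n]_z lam [set x | S (tins i (x, z))])%E.
Proof.
move=> mS; rewrite (leb_tins i mS).
(* The two iterated products agree on rectangles, hence on all measurable sets. *)
transitivity ((lam \x^ leb R n)%E (@tins R n i @^-1` S)).
  apply: product_measure_unique; last exact: measurable_tins_preimage.
  by move=> A B mA mB; exact: product_measure2E.
apply: eq_integral => z _ /=; congr (lam _).
by apply/seteqP; split => x; rewrite /ysection /= inE.
Qed.

Lemma fubini_tins (n : nat) (i : 'I_n.+1) (f : n.+1.-tuple mR -> \bar R) :
  (leb R n.+1).-integrable setT f ->
  measurable_fun setT (fun z => \int[lam]_x f (tins i (x, z)))%E /\
  (\int[leb R n.+1]_t f t = \int[leb R n]_z \int[lam]_x f (tins i (x, z)))%E.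
Proof.
move=> intf.
have [intg eqg] := @integral_transfer _ _ _ _ R (lam \x leb R n)%E (leb R n.+1)
  (@tins R n i) 1 f (@measurable_tins _ _ _) ler01
  (fun S mS => etrans (esym (leb_tins i mS)) (esym (mul1e _))) intf.
split; first exact: measurable_fubini_G intg.
by rewrite -[LHS]mul1e -eqg -(integral21_prod_meas1 intg).
Qed.

Lemma leb_slice_null n (i : 'I_n.+1) (S : set (n.+1.-tuple mR)) :
  measurable S -> (forall z, lam [set x | S (tins i (x, z))] = 0%E) ->
  leb R n.+1 S = 0%E.
Proof.
by move=> mS S0; rewrite (leb_tins_slice i mS) integral0_eq.
Qed.

Lemma measurable_dot n (p : 'rV[R]_n) :
  measurable_fun setT (fun t : n.-tuple mR => dot p (tvec t)).
Proof.
rewrite /dot; apply: measurable_sum => i.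
apply: measurable_funM => //.
apply: (eq_measurable_fun (fun t : n.-tuple mR => tnth t i)).
  by move=> t _; rewrite mxE.
exact: measurable_tnth.
Qed.

Lemma measurable_hyperplane n (p : 'rV[R]_n) (c : R) :
  measurable [set t : n.-tuple mR | dot p (tvec t) = c].
Proof.
rewrite -[X in measurable X]setTI.
have -> : [set t : n.-tuple mR | dot p (tvec t) = c] =
    (fun t => dot p (tvec t)) @^-1` [set c] by [].
by apply: measurable_dot.
Qed.

(** In a coordinate direction where the normal does not vanish, every line meets the hyperplane in
    one point, so all slices are null. *)
Lemma hyperplane_null n (p : 'rV[R]_n) (c : R) : p != 0 ->
  leb R n [set t | dot p (tvec t) = c] = 0%E.
Proof.
case: n p => [|n] p p0; first by rewrite thinmx0 eqxx in p0.
have [i pi0] : exists i, p 0 i != 0 by apply/rV0Pn.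
apply: (@leb_slice_null n i _ (measurable_hyperplane p c)) => z.
pose s := \sum_(k < n) p 0 (lift i k) * tnth z k.
rewrite [X in lam X](_ : _ = [set (c - s) / p 0 i]) ?lebesgue_measure_set1//.
have E x : dot p (tvec (tins i (x, z))) = p 0 i * x + s.
  rewrite /dot (bigD1_ord i)//= mxE tinsE; congr (_ + _).
  by apply: eq_bigr => k _; rewrite mxE tins_lift.
apply/seteqP; split => x /=; rewrite E.
  by move=> <-; field.
by move=> ->; field.
Qed.

End tuple_measure2.

(** * Affine changes of variables *)

Section affine_maps.
Context (R : realType).
Local Notation mR := (measurableTypeR R).
Local Notation lam := (@lebesgue_measure R).

Definition taffine n p (B : 'M[R]_(n, p)) (c : 'rV[R]_p) (t : n.-tuple mR) : p.-tuple mR :=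
  vtup (tvec t *m B + c).

Lemma measurable_taffine n p (B : 'M[R]_(n, p)) c :
  measurable_fun setT (taffine B c).
Proof.
apply/measurable_fun_tnthP => j.
apply: (eq_measurable_fun (fun t => dot (col j B)^T (tvec t) + c 0 j)).
  move=> t _; rewrite /= tnth_mktuple !mxE; congr (_ + _).
  by apply: eq_bigr => i _; rewrite !mxE mulrC.
by apply: measurable_funD => //; exact: measurable_dot.
Qed.

(** The factor refers to preimages: for an affine bijection it is the reciprocal of the absolute
    determinant, and factors multiply under composition. *)
Definition lscale n (phi : n.-tuple mR -> n.-tuple mR) (k : R) :=
  measurable_fun setT phi /\
  forall S, measurable S -> leb R n (phi @^-1` S) = (k%:E * leb R n S)%E.

Lemma lscale_comp n phi psi k l : @lscale n phi k -> @lscale n psi l ->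
  lscale (psi \o phi) (k * l).
Proof.
move=> [mp Hp] [mq Hq]; split; first exact: measurableT_comp.
move=> S mS; rewrite comp_preimage Hp ?Hq ?muleA//.
by rewrite -[X in measurable X]setTI; exact: mq.
Qed.

(** On each line in direction [i] the map is [a * x + b] with [b] fixed, so the one-dimensional
    factor integrates over the lines. The affine maps below are composed of such maps. *)
Lemma lscale_coord n (i : 'I_n.+1) (a : R) (l : n.-tuple mR -> mR) : a != 0 ->
  measurable_fun setT l ->
  lscale (fun t => tins i (a * (tdel i t).1 + l (tdel i t).2, (tdel i t).2)) `|a|^-1.
Proof.
move=> a0 ml.
have mphi : measurable_fun setT (fun t : n.+1.-tuple mR =>
    tins i (a * (tdel i t).1 + l (tdel i t).2, (tdel i t).2)).
  have m1 := measurableT_comp measurable_fst (@measurable_tdel R n i).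
  have m2 := measurableT_comp measurable_snd (@measurable_tdel R n i).
  apply: measurableT_comp; first exact: measurable_tins.
  apply: measurable_fun_pair => //.
  apply: measurable_funD; first exact: measurable_funM.
  exact: measurableT_comp.
split => // S mS.
rewrite (leb_tins_slice i mS) (leb_tins_slice i); last first.
  by rewrite -[X in measurable X]setTI; exact: mphi.
rewrite -ge0_integralZl//; last first.
  have := @measurable_fun_ysection _ _ _ _ R lam _ (measurable_tins_preimage i mS).
  congr measurable_fun; apply/funext => z /=; congr (lam _).
  by apply/seteqP; split => x; rewrite /ysection /= inE.
apply: eq_integral => z _.
rewrite -(lebesgue_measure_affine (l z))//; last first.
  have := measurable_ysection z (measurable_tins_preimage i mS).
  by congr measurable; apply/seteqP; split => x; rewrite /ysection /= inE.
by congr (lam _); apply/seteqP; split => x; rewrite /preimage /mkset ?tinsK.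
Qed.

(** Vectors are rows, so [E] differs from the identity only in column [i]: coordinate [i] alone is
    changed. *)
Lemma lscale_affine_coord n (i : 'I_n.+1) (E : 'M[R]_n.+1) (c : 'rV[R]_n.+1) :
  E i i != 0 -> (forall j k, k != i -> E j k = (j == k)%:R) ->
  (forall k, k != i -> c 0 k = 0) -> lscale (taffine E c) `|E i i|^-1.
Proof.
move=> Eii Ej cj.
pose l z := dot (\row_k E (lift i k) i) (tvec z) + c 0 i : mR.
have ml : measurable_fun setT l.
  by apply: measurable_funD => //; exact: measurable_dot.
have := lscale_coord i Eii ml; congr lscale.
apply/funext => t; apply: eq_from_tnth => j.
rewrite !tnth_mktuple !mxE; case: unliftP => [k ->|->].
  rewrite tnth_mktuple cj ?addr0 ?neq_lift// 1?eq_sym ?neq_lift//.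
  rewrite (bigD1 (lift i k))//= Ej ?eqxx ?mulr1 1?eq_sym ?neq_lift// !mxE.
  rewrite big1 ?addr0// => h hk.
  by rewrite Ej ?(negbTE hk) ?mulr0// eq_sym neq_lift.
rewrite [in RHS](bigD1_ord i)//= !mxE /l addrA mulrC; congr (_ + _ + _).
by apply: eq_bigr => k _; rewrite !mxE tnth_mktuple mulrC.
Qed.

Lemma taffine_comp n p q (B : 'M[R]_(n, p)) c (C : 'M[R]_(p, q)) d :
  taffine C d \o taffine B c = taffine (B *m C) (c *m C + d).
Proof. by apply/funext => t; rewrite /taffine /= vtupK mulmxDl mulmxA addrA. Qed.

Lemma ord2P (i : 'I_2) : i = 0 \/ i = 1.
Proof. by case: i => [[|[|//]] ?]; [left|right]; apply/val_inj. Qed.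

Lemma sum_ord2 (V : zmodType) (F : 'I_2 -> V) : \sum_i F i = F 0 + F 1.
Proof.
by rewrite !big_ord_recl big_ord0 addr0; congr (F _ + F _); apply/val_inj.
Qed.

Lemma det_mx22 (A : 'M[R]_2) : \det A = A 0 0 * A 1 1 - A 0 1 * A 1 0.
Proof.
rewrite (expand_det_row _ 0) sum_ord2 /cofactor !det_mx11 !mxE /=.
rewrite expr0 expr1 mul1r mulN1r mulrN.
by congr (_ * A _ _ - _ * A _ _); apply/val_inj.
Qed.

Lemma lscale_linear2 (B : 'M[R]_2) : \det B != 0 ->
  lscale (taffine B 0) `|\det B|^-1.
Proof.
have pos (C : 'M[R]_2) : C 0 0 != 0 -> \det C != 0 ->
    lscale (taffine C 0) `|\det C|^-1.
  move=> c0 dC.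
  (* [E1 *m E2 = C] is elimination with pivot [C 0 0]: [E1] changes coordinate 0 only, [E2]
     coordinate 1 only. *)
  pose E1 : 'M[R]_2 := \matrix_(i, j) if j == 0 then C i 0 else (i == j)%:R.
  pose E2 : 'M[R]_2 := \matrix_(i, j) if j == 0 then (i == j)%:R else
    if i == 0 then C 0 1 / C 0 0 else \det C / C 0 0.
  have -> : taffine C 0 = taffine E2 0 \o taffine E1 0.
    rewrite taffine_comp mul0mx addr0; congr taffine.
    apply/matrixP => i j; rewrite mxE sum_ord2 !mxE det_mx22 /=.
    by case: (ord2P i) => ->; case: (ord2P j) => -> /=; field.
  have -> : `|\det C|^-1 = `|E1 0 0|^-1 * `|E2 1 1|^-1.
    by rewrite !mxE /= -invfM -normrM; congr (`|_|^-1); field.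
  apply: lscale_comp; apply: lscale_affine_coord.
  - by rewrite mxE.
  - by move=> j k k0; rewrite mxE (negbTE k0).
  - by move=> k _; rewrite mxE.
  - by rewrite mxE /= mulf_neq0// invr_eq0.
  - by move=> j k; case: (ord2P k) => -> // _; rewrite mxE.
  - by move=> k _; rewrite mxE.
move=> dB; have [B00|] := eqVneq (B 0 0) 0; last by move=> ?; exact: pos.
(* When the pivot is zero, [S 1] adds the second row to the first. The new pivot is [B 1 0], nonzero
   because [B] is invertible, and [S (-1)] undoes the change. *)
pose S (s : R) : 'M[R]_2 := \matrix_(i, j) if i == j then 1 else
  if i == 0 then s else 0.
pose B' := S 1 *m B.
have dS s : \det (S s) = 1 by rewrite det_mx22 !mxE /=; ring.
have dB' : \det B' = \det B by rewrite det_mulmx dS mul1r.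
have -> : taffine B 0 = taffine B' 0 \o taffine (S (-1)) 0.
  rewrite taffine_comp mul0mx addr0; congr taffine.
  rewrite mulmxA [X in X *m B](_ : _ = 1%:M) ?mul1mx//.
  apply/matrixP => i j; rewrite mxE sum_ord2 !mxE.
  by case: (ord2P i) => ->; case: (ord2P j) => -> /=; ring.
have -> : `|\det B|^-1 = `|S (-1) 1 1|^-1 * `|\det B'|^-1.
  by rewrite dB' mxE eqxx normr1 invr1 mul1r.
apply: lscale_comp; last first.
  apply: pos; rewrite ?dB'// mxE sum_ord2 !mxE /= B00 mulr0 add0r mul1r.
  by apply: contraNneq dB => B10; rewrite det_mx22 B00 B10 mulr0 mul0r subrr.
apply: lscale_affine_coord.
- by rewrite mxE eqxx oner_eq0.
- by move=> j k; case: (ord2P k) => -> // _; rewrite mxE; case: (ord2P j) => ->.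
- by move=> k _; rewrite mxE.
Qed.

Lemma lscale_translation n (c : 'rV[R]_n) : lscale (taffine 1%:M c) 1.
Proof.
(* Coordinates are translated one at a time, along a list. *)
suff H (s : seq 'I_n) : uniq s ->
    lscale (taffine 1%:M (\sum_(i <- s) c 0 i *: delta_mx 0 i)) 1.
  by rewrite [c]row_sum_delta; apply: H; exact: index_enum_uniq.
elim: s => [|i s IH] /=.
  move=> _; rewrite big_nil; split; first exact: measurable_taffine.
  move=> S mS; rewrite mul1e; congr (leb R n _).
  by apply/seteqP; split => t; rewrite /taffine /= mulmx1 addr0 tvecK.
move=> /andP[_ us]; rewrite big_cons.
case: n i c s us IH => [[]//|n] i c s us IH.
have -> : taffine 1%:M (c 0 i *: delta_mx 0 i + \sum_(i <- s) c 0 i *: delta_mx 0 i) =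
    taffine 1%:M (c 0 i *: delta_mx 0 i) \o
    taffine 1%:M (\sum_(i <- s) c 0 i *: delta_mx 0 i).
  by rewrite taffine_comp !mulmx1 addrC.
rewrite -[X in lscale _ X](mulr1 1); apply: lscale_comp; first exact: IH.
have := @lscale_affine_coord n i 1%:M (c 0 i *: delta_mx 0 i).
rewrite mxE eqxx normr1 invr1; apply.
- by rewrite oner_eq0.
- by move=> j k _; rewrite mxE.
- by move=> k ki; rewrite !mxE eqxx (negbTE ki) mulr0.
Qed.

(** One and two are the dimensions of the facets of polygons and polyhedra. *)
Lemma lscale_affine n (B : 'M[R]_n) (c : 'rV[R]_n) : n = 1%N \/ n = 2%N ->
  \det B != 0 -> lscale (taffine B c) `|\det B|^-1.
Proof.
move=> n12 dB.
have -> : taffine B c = taffine 1%:M c \o taffine B 0.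
  by rewrite taffine_comp mul0mx add0r mulmx1.
rewrite -[X in lscale _ X]mulr1; apply: lscale_comp; last exact: lscale_translation.
case: n12 => n12; subst n; last exact: lscale_linear2.
rewrite det_mx11 in dB *.
apply: lscale_affine_coord => //.
  by move=> j k; rewrite ord1 eqxx.
by move=> k; rewrite ord1 eqxx.
Qed.

End affine_maps.

(** * Measurability of open sets and continuous functions *)

Section open_measurable_tuple.
Context (R : realType).
Local Notation mR := (measurableTypeR R).

Lemma rV_ballP n (D : set 'rV[R]_n) (x : 'rV[R]_n) :
  nbhs x D <-> exists2 e : R, 0 < e &
    forall y : 'rV[R]_n, (forall i, `|x 0 i - y 0 i| < e) -> D y.
Proof.
split.
  move=> /nbhs_ballP[e /= e0 eD]; exists e => // y xy; apply: eD.
  split => // i j; rewrite ord1; exact: xy.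
move=> [e e0 eD]; apply/nbhs_ballP; exists e => //= y [_ xy]; apply: eD => i.
exact: xy.
Qed.

(** Tuples carry the product sigma-algebra, so an open set is written as a countable union: the
    cubes with rational centre and radius [1 / (k + 1)] that it contains. *)
Lemma open_tuple_measurable n (D : set 'rV[R]_n) : open D ->
  measurable [set t : n.-tuple mR | D (tvec t)].
Proof.
move=> oD.
pose box (u : {ffun 'I_n -> rat} * nat) : set (n.-tuple mR) :=
  [set t | forall i, `|tnth t i - ratr (u.1 i)| < u.2.+1%:R^-1].
have mbox u : measurable (box u).
  have -> : box u = \bigcap_(i in [set: 'I_n])
      [set t | `|tnth t i - ratr (u.1 i)| < u.2.+1%:R^-1].
    by apply/seteqP; split => t /= H i => [_|]; exact: H.
  apply: fin_bigcap_measurable => [|i _]; first exact: finite_finset.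
  pose g (t : n.-tuple mR) : R := `|tnth t i - ratr (u.1 i)|.
  have mg : measurable_fun setT g.
    apply: measurableT_comp => //; apply: measurable_funD => //.
    exact: measurable_tnth.
  rewrite -[X in measurable X]setTI.
  rewrite (_ : [set t | _] = g @^-1` `]-oo, u.2.+1%:R^-1[%classic).
    exact: mg.
  by apply/seteqP; split => t /=; rewrite in_itv.
pose F u := if `[< box u `<=` [set t | D (tvec t)] >] then box u else set0.
rewrite (_ : [set t | _] = \bigcup_u F u).
  apply: countable_bigcupT_measurable => [|u]; first exact: countableP.
  by rewrite /F; case: ifP.
apply/seteqP; split => [t /= Dt|t [u _]]; last first.
  by rewrite /F; case: asboolP => // uD /uD.
have /rV_ballP[e e0 eD] : nbhs (tvec t) D by exact: open_nbhs_nbhs.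
(* A cube of radius below [e / 2] that contains [t] stays within [e] of [t]. *)
have [k] := ltr_add_invr (divr_gt0 e0 (ltr0n R 2) : 0 < e / 2).
rewrite add0r => ke.
have k0 : 0 < k.+1%:R^-1 :> R by rewrite invr_gt0.
have /(_ _)/cid-/all_sig[q Hq] : forall i, exists q : rat,
    `|tnth t i - ratr q| < k.+1%:R^-1.
  move=> i.
  have [|q] := @rat_in_itvoo R (tnth t i) (tnth t i + k.+1%:R^-1).
    by rewrite ltrDl.
  rewrite in_itv/= => /andP[q1 q2]; exists q.
  by rewrite distrC ger0_norm ?subr_ge0 1?ltW// ltrBlDl.
exists ([ffun i => q i], k) => //.
have tbox : box ([ffun i => q i], k) t by move=> i; rewrite /= ffunE.
rewrite /F; case: asboolP => // -[] s sbox; apply: eD => i; rewrite !mxE.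
have := sbox i; have := tbox i; rewrite /= => h1 h2.
rewrite (le_lt_trans (ler_distD (ratr ([ffun i => q i] i)) _ _))//.
by rewrite (distrC _ (tnth s i)) [e]splitr ltrD//; exact: lt_trans ke.
Qed.

Lemma continuous_tuple_measurable n (f : 'rV[R]_n -> R) : continuous f ->
  measurable_fun setT (fun t : n.-tuple mR => f (tvec t)).
Proof.
move=> cf; apply: (measurability _ (RGenOpens.measurableE R)).
move=> _ [_ [a [b ->] <-]]; rewrite setTI.
apply: (@open_tuple_measurable n (f @^-1` `]a, b[%classic)).
by move/continuousP: cf; apply; exact: interval_open.
Qed.

End open_measurable_tuple.

(** * Polynomials and integrals over bounded open sets *)

Section polynomials.
Context (R : realType) (n : nat).
Local Notation mR := (measurableTypeR R).
Implicit Types (p q : mpoly n R) (x y : 'rV[R]_n) (D : set 'rV[R]_n).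

Definition mvar (i : 'I_n) : mpoly n R := mpolyX R (mnm1 i).

(** Building polynomials by one variable at a time suits properties that pass through the ring
    operations: continuity, boundedness, restriction to a line. *)
Lemma mpoly_ring_ind (P : mpoly n R -> Prop) :
  (forall c, P (mpolyC n c)) -> (forall p q, P p -> P q -> P (p + q)) ->
  (forall p i, P p -> P (p * mvar i)) -> forall p, P p.
Proof.
move=> PC PD PX p; elim/mpolyind: p => [|c m p _ _ Pp]; first by rewrite -mpolyC0.
apply: PD => //; rewrite -mul_mpolyC mpolyXE_id.
elim: (index_enum _) (mpolyC n c) (PC c) => [|i s IH] q Pq.
  by rewrite big_nil mulr1.
rewrite big_cons mulrA; apply: IH.
by elim: (m i) => [|k IHk]; rewrite ?mulr1// exprSr mulrA; exact: PX.
Qed.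

Lemma evC c x : ev (mpolyC n c) x = c. Proof. exact: mevalC. Qed.
Lemma evD p q x : ev (p + q) x = ev p x + ev q x. Proof. exact: mevalD. Qed.
Lemma evB p q x : ev (p - q) x = ev p x - ev q x. Proof. exact: mevalB. Qed.
Lemma evM p q x : ev (p * q) x = ev p x * ev q x. Proof. exact: mevalM. Qed.
Lemma evZ c p x : ev (c *: p) x = c * ev p x. Proof. exact: mevalZ. Qed.
Lemma ev0 x : ev (0 : mpoly n R) x = 0. Proof. exact: meval0. Qed.
Lemma ev_var i x : ev (mvar i) x = x 0 i. Proof. exact: mevalXU. Qed.
Lemma ev_sum (I : Type) (s : seq I) (P : pred I) (F : I -> mpoly n R) x :
  ev (\sum_(i <- s | P i) F i) x = \sum_(i <- s | P i) ev (F i) x.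
Proof. exact: (raddf_sum (meval (fun i => x 0 i))). Qed.

Lemma ev_continuous p : continuous (ev p).
Proof.
elim/mpoly_ring_ind: p => [c|p q cp cq|p i cp] x.
- have -> : ev (mpolyC n c) = cst c by apply/funext => y; rewrite evC.
  exact: cst_continuous.
- have -> : ev (p + q) = ev p \+ ev q by apply/funext => y; rewrite evD.
  exact: cvgD (cp x) (cq x).
- have -> : ev (p * mvar i) = ev p \* (fun y => y 0 i).
    by apply/funext => y; rewrite evM ev_var.
  exact: cvgM (cp x) (@coord_continuous R 1 n 0 i x).
Qed.

Definition bset D := exists r : R, forall x, D x -> forall i, `|x 0 i| <= r.

Lemma ev_bounded p D : bset D -> exists C : R, forall x, D x -> `|ev p x| <= C.
Proof.
move=> [r Dr]; elim/mpoly_ring_ind: p => [c|p q [C hC] [C' hC']|p i [C hC]].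
- by exists `|c| => x _; rewrite evC.
- exists (C + C') => x Dx; rewrite evD (le_trans (ler_normD _ _))//.
  by rewrite lerD ?hC ?hC'.
- exists (C * r) => x Dx; rewrite evM ev_var normrM ler_pM//; first exact: hC.
  exact: Dr.
Qed.

Lemma ev_measurable p (A : set (n.-tuple mR)) :
  measurable_fun A (fun t : n.-tuple mR => ev p (tvec t)).
Proof.
apply: (measurable_funS measurableT) => //.
exact: (continuous_tuple_measurable (@ev_continuous p)).
Qed.

(** One [q] carries both the value and the derivative: [mderiv i] becomes the one-variable
    derivative along the line, ready for the fundamental theorem of calculus. *)
Lemma ev_line p (i : 'I_n) x : exists q : {poly R}, forall t : R,
  ev p (x + t *: delta_mx 0 i) = q.[t] /\
  ev (mderiv i p) (x + t *: delta_mx 0 i) = q^`().[t].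
Proof.
elim/mpoly_ring_ind: p => [c|p q [P HP] [Q HQ]|p j [P HP]].
- by exists c%:P => t; rewrite evC hornerC derivC mderivC ev0 horner0.
- exists (P + Q) => t; have [h1 h2] := HP t; have [h3 h4] := HQ t.
  by rewrite derivD mderivD !evD !hornerD h1 h2 h3 h4.
- exists (P * ((x 0 j)%:P + (i == j)%:R *: 'X)) => t; have [h1 h2] := HP t.
  rewrite derivM mderivM derivD derivC derivZ derivX add0r !evD !evM ev_var
    !hornerE h1 h2 /mvar mderivX.
  rewrite evZ !mxE eqxx /=.
  have -> : ((mnm1 j) i)%:R * ev (mpolyX R (mnm_sub (mnm1 j) (mnm1 i)))
      (x + t *: delta_mx 0 i) = (i == j)%:R.
    rewrite mnm1E eq_sym; have [<-|_] := eqVneq i j; last by rewrite mul0r.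
    rewrite mul1r (_ : mnm_sub _ _ = @mnm0 n) ?mpolyX0 ?[ev _ _]meval1//.
    by apply/mnmP => k; rewrite mnmBE subnn mnm0E.
  by rewrite eq_sym; split; ring.
Qed.

End polynomials.

Lemma poly_eq0_itv (R : realType) (q : {poly R}) (e : R) : 0 < e ->
  (forall t, `|t| < e -> q.[t] = 0) -> q = 0.
Proof.
move=> e0 H; apply/eqP; apply: contraT => q0.
(* These are [size q] distinct zeros, one more than a nonzero [q] can have; [k.+2] keeps them
   strictly below [e]. *)
pose s := [seq e / k.+2%:R | k <- iota 0 (size q)].
have := @max_poly_roots R q s q0; rewrite size_map size_iota ltnn => -> //.
  apply/allP => _ /mapP[k _ ->]; rewrite /root H// gtr0_norm ?divr_gt0//.
  by rewrite ltr_pdivrMr// ltr_pMr// ltr1n.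
rewrite map_inj_uniq ?iota_uniq// => j k /(mulfI (lt0r_neq0 e0))/invr_inj/eqP.
by rewrite eqr_nat => /eqP[].
Qed.

Lemma msize_mderiv (R : realType) n (p : mpoly n R) i k :
  (msize p <= k.+1)%N -> (msize (mderiv i p) <= k)%N.
Proof.
move=> pk; rewrite msizeE; apply/bigmax_leqP_seq => m.
rewrite mcoeff_msupp mcoeff_deriv => H _.
have /msize_mdeg_lt : mnm_add m (mnm1 i) \in msupp p.
  by rewrite mcoeff_msupp; apply: contraNneq H => ->; rewrite mul0rn.
by rewrite mdegD mdeg1 addn1 => /leq_trans/(_ pk); rewrite ltnS.
Qed.

Section polynomials_open.
Context (R : realType) (n : nat).
Local Notation mR := (measurableTypeR R).
Implicit Types (p q : mpoly n R) (x y : 'rV[R]_n) (D : set 'rV[R]_n).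

(** Induction on the size. The partial derivatives vanish on [D] too, since [p] vanishes on short
    segments around each point, and they have smaller size; hence they are all zero and [p] is
    constant. *)
Lemma ev_eq0_open p D : open D -> D !=set0 -> (forall x, D x -> ev p x = 0) -> p = 0.
Proof.
move=> oD [x0 Dx0].
move: {2}(msize p) (leqnn (msize p)) => k.
elim: k p => [|k IH] p; first by rewrite leqn0 msize_poly_eq0 => /eqP.
move=> pk p0.
have dp0 i : mderiv i p = 0.
  apply: IH; first exact: msize_mderiv.
  move=> x Dx; have [q Hq] := ev_line p i x.
  have /rV_ballP[e e0 eD] : nbhs x D by exact: open_nbhs_nbhs.
  have q0 : q = 0.
    apply: (poly_eq0_itv e0) => t te; have [<- _] := Hq t; apply: p0.
    apply: eD => j; rewrite !mxE opprD addrA subrr add0r normrN normrM eqxx /=.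
    by case: (j == i); rewrite ?normr1 ?mulr1// normr0 mulr0.
  by have [_] := Hq 0; rewrite scale0r addr0 q0 derivC horner0.
(* A monomial other than 1 contains some variable, and its coefficient survives in the derivative in
   that variable, up to a nonzero integer factor. *)
have : p = mpolyC n (mcoeff (@mnm0 n) p).
  apply/mpolyP => m; rewrite mcoeffC.
  have [->|m0] := eqVneq m (@mnm0 n); first by rewrite mulr1.
  rewrite mulr0.
  have [i mi] : exists i, m i != 0%N.
    apply/existsP; rewrite -negb_forall; apply: contra m0 => /forallP H.
    by apply/eqP/mnmP => i; rewrite mnm0E; apply/eqP/H.
  have := congr1 (mcoeff (mnm_sub m (mnm1 i))) (dp0 i).
  rewrite mcoeff_deriv mcoeff0 submK ?lep1mP//.
  by move/eqP; rewrite mulrn_eq0 /= => /eqP.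
by move=> pC; have := p0 _ Dx0; rewrite pC evC => ->; rewrite mpolyC0.
Qed.

End polynomials_open.

Lemma rV_ballE (R : realType) n (c : 'rV[R]_n) (e : R) : 0 < e ->
  [set x : 'rV[R]_n | forall i, `|c 0 i - x 0 i| < e] = ball c e.
Proof.
move=> e0; apply/seteqP; split => x /=.
  by move=> H; split => // i j; rewrite ord1; exact: H.
by move=> [_ H] i; exact: H.
Qed.

Lemma leb_box (R : realType) n (c : 'rV[R]_n) (e : R) : 0 < e ->
  leb R n [set t | forall i, `|c 0 i - tvec t 0 i| < e] = ((e *+ 2) ^+ n)%:E.
Proof.
move=> e0; elim: n c => [|n IH] c.
  by rewrite /= /dirac indicE mem_set// => -[].
rewrite /= /pushforward.
rewrite (_ : _ @^-1` _ = ball (c 0 0) e `*`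
    [set t | forall i, `|(\row_k c 0 (lift 0 k)) 0 i - tvec t 0 i| < e]).
  rewrite product_measure1E; last 2 first.
  - exact: measurable_ball.
  - have := @open_tuple_measurable R n (ball (\row_k c 0 (lift 0 k)) e) (ball_open _ _).
    by rewrite -rV_ballE.
  rewrite [X in (X * _)%E](lebesgue_measure_ball (c 0 0) (ltW e0)).
  by rewrite [X in (_ * X)%E]IH exprS EFinM.
apply/seteqP; split => -[x t] /=.
  move=> H; split.
    by have := H 0; rewrite mxE.
  by move=> i; have := H (lift 0 i); rewrite !mxE tnthS.
move=> [h1 h2] i; case: (unliftP 0 i) => [k ->|->]; rewrite mxE.
  by have := h2 k; rewrite !mxE tnthS.
exact: h1.
Qed.

Lemma Rintegral_sum d (T : measurableType d) (R : realType)
    (mu : {measure set T -> \bar R}) (D : set T) (I : Type) (s : seq I)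
    (P : pred I) (F : I -> T -> R) :
  measurable D -> (forall i, P i -> mu.-integrable D (EFin \o F i)) ->
  mu.-integrable D (EFin \o (fun x => \sum_(i <- s | P i) F i x)) /\
  \int[mu]_(x in D) (\sum_(i <- s | P i) F i x) =
    \sum_(i <- s | P i) \int[mu]_(x in D) F i x.
Proof.
move=> mD iF; elim: s => [|i s [IH1 IH2]].
  rewrite big_nil; split.
    by apply: (eq_integrable mD _ _ _ (integrable0 mu D)) => x _; rewrite /= big_nil.
  by rewrite /Rintegral integral0_eq// => x _; rewrite big_nil.
have [Pi|nPi] := boolP (P i); last first.
  rewrite big_cons (negbTE nPi) -IH2; split.
    by apply: (eq_integrable mD _ _ _ IH1) => x _; rewrite /= big_cons (negbTE nPi).
  by apply: eq_Rintegral => x _; rewrite big_cons (negbTE nPi).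
have E x : \sum_(j <- i :: s | P j) F j x = F i x + \sum_(j <- s | P j) F j x.
  by rewrite big_cons Pi.
split.
  by apply: (eq_integrable mD _ _ _ (integrableD mD (iF i Pi) IH1)) => x _ /=; rewrite E.
rewrite big_cons Pi -IH2 -RintegralD ?iF//.
by apply: eq_Rintegral => x _; rewrite E.
Qed.

Section integ_lemmas.
Context (R : realType) (n : nat).
Local Notation mR := (measurableTypeR R).
Implicit Types (D : set 'rV[R]_n) (F G : 'rV[R]_n -> R).

Definition tset D : set (n.-tuple mR) := [set t | D (tvec t)].

Definition intg D F :=
  (leb R n).-integrable (tset D) (EFin \o (fun t : n.-tuple mR => F (tvec t))).

Lemma leb_open_gt0 D : open D -> D !=set0 -> (0 < leb R n (tset D))%E.
Proof.
move=> oD [x Dx].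
have /rV_ballP[e e0 eD] : nbhs x D by exact: open_nbhs_nbhs.
apply: (@lt_le_trans _ _ ((e *+ 2) ^+ n)%:E).
  by rewrite lte_fin exprn_gt0// mulrn_wgt0.
rewrite -(leb_box x e0); apply: le_measure; rewrite ?inE.
- by have := @open_tuple_measurable R n (ball x e) (ball_open _ _); rewrite -rV_ballE.
- exact: open_tuple_measurable.
- by move=> t /= H; exact: eD.
Qed.

Lemma leb_bset_lty D : open D -> bset D -> (leb R n (tset D) < +oo)%E.
Proof.
move=> oD [r Dr].
have e0 : 0 < `|r| + 1 by rewrite ltr_wpDl.
apply: (@le_lt_trans _ _ (((`|r| + 1) *+ 2) ^+ n)%:E); last exact: ltry.
rewrite -(leb_box 0 e0); apply: le_measure; rewrite ?inE.
- exact: open_tuple_measurable.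
- have := @open_tuple_measurable R n (ball 0 (`|r| + 1)) (ball_open _ _).
  by rewrite -rV_ballE.
- move=> t /= /Dr H i; rewrite mxE add0r normrN (le_lt_trans (H i))//.
  by rewrite (le_lt_trans (ler_norm r))// ltrDl.
Qed.

Lemma intg_bounded D F : open D -> bset D ->
  measurable_fun (tset D) (fun t : n.-tuple mR => F (tvec t)) ->
  (exists C : R, forall x, D x -> `|F x| <= C) -> intg D F.
Proof.
move=> oD bD mF [C HC]; apply: measurable_bounded_integrable => //.
- exact: open_tuple_measurable.
- exact: leb_bset_lty.
- exists C; split; first exact: num_real.
  by move=> M CM t Dt; exact: le_trans (HC _ Dt) (ltW CM).
Qed.

Lemma intg_ev D (p : mpoly n R) : open D -> bset D -> intg D (ev p).
Proof.
move=> oD bD; apply: intg_bounded => //; first exact: ev_measurable.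
exact: ev_bounded.
Qed.

Lemma integ_eq D F G : (forall x, D x -> F x = G x) -> integ D F = integ D G.
Proof.
by move=> FG; apply: eq_Rintegral => t; rewrite inE /= => Dt; rewrite FG.
Qed.

Lemma integD D F G : open D -> intg D F -> intg D G ->
  integ D (fun x => F x + G x) = integ D F + integ D G.
Proof. by move=> oD iF iG; rewrite -RintegralD//; exact: open_tuple_measurable. Qed.

Lemma integZ D (c : R) F : open D -> intg D F ->
  integ D (fun x => c * F x) = c * integ D F.
Proof. by move=> oD iF; rewrite -RintegralZl//; exact: open_tuple_measurable. Qed.

Lemma intgZ D (c : R) F : open D -> intg D F -> intg D (fun x => c * F x).
Proof.
move=> oD iF; have := integrableZl (open_tuple_measurable oD) c iF.
by apply: eq_integrable; first exact: open_tuple_measurable.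
Qed.

Lemma integ_sum D (I : Type) (s : seq I) (c : I -> R) (F : I -> 'rV[R]_n -> R) :
  open D -> (forall i, intg D (F i)) ->
  intg D (fun x => \sum_(i <- s) c i * F i x) /\
  integ D (fun x => \sum_(i <- s) c i * F i x) = \sum_(i <- s) c i * integ D (F i).
Proof.
move=> oD iF; have [iS sE] := @Rintegral_sum _ _ R (leb R n) (tset D) I s xpredT
  (fun i t => c i * F i (tvec t)) (open_tuple_measurable oD)
  (fun i _ => intgZ (c i) oD (iF i)).
by split => //; rewrite [LHS]sE; apply: eq_bigr => i _; exact: integZ.
Qed.

Lemma integ_ge0 D F : (forall x, D x -> 0 <= F x) -> 0 <= integ D F.
Proof. by move=> H; apply: Rintegral_ge0 => t Dt; exact: H. Qed.

(** [p] vanishes almost everywhere on [D]. The part of [D] where it does not is open and null, hence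
    empty, and a polynomial that vanishes on a nonempty open set is zero. *)
Lemma integ_sqr_eq0 D (p : mpoly n R) : open D -> bset D -> D !=set0 ->
  integ D (fun x => ev p x * ev p x) = 0 -> p = 0.
Proof.
move=> oD bD D0 ip.
have mD := open_tuple_measurable oD.
have pp : intg D (ev (p * p)) by exact: intg_ev.
have E0 : (\int[leb R n]_(t in tset D) `|(ev (p * p) (tvec t))%:E| = 0)%E.
  rewrite (eq_integral (fun t => (ev (p * p) (tvec t))%:E)); last first.
    by move=> t _; rewrite gee0_abs// lee_fin evM -expr2 sqr_ge0.
  have fn := integrable_fin_num mD pp.
  rewrite -(fineK fn); congr EFin; rewrite -[RHS]ip /integ /Rintegral.
  by congr fine; apply: eq_integral => t _; rewrite /= evM.
have mpp := measurable_int _ pp.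
have /ae_eq_integral_abs := E0; move=> /(_ mD mpp) [N [mN N0 sub]].
apply/eqP; apply: contraT => pn0.
have [x [Dx px]] : exists x, D x /\ ev p x != 0.
  apply: contrapT => H; move/eqP: pn0; apply; apply: (ev_eq0_open oD D0) => x Dx.
  by apply/eqP; apply: contraT => px; exfalso; apply: H; exists x.
pose U := D `&` [set x | ev p x != 0].
have oU : open U.
  apply: openI => //; have /continuousP := @ev_continuous R n p.
  move=> /(_ [set y | y != 0]); apply; exact: open_neq.
have := leb_open_gt0 oU (ex_intro _ x (conj Dx px)).
rewrite ltNge => /negP[]; rewrite -N0; apply: le_measure; rewrite ?inE//.
  exact: open_tuple_measurable.
move=> t [Dt pt]; apply: sub => /= /(_ Dt) [] /eqP.
by rewrite evM mulf_eq0 (negbTE pt).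
Qed.

End integ_lemmas.

(** * Integration along a line *)

(** Such a function has zero derivative everywhere. *)
Lemma locally_cst (R : realType) (g : R -> R) :
  (forall t, \forall s \near t, g s = g t) -> forall s t, g s = g t.
Proof.
move=> H s t; apply: is_derive_0_is_cst => x.
apply: (@near_eq_is_derive R _ _ (cst (g x))).
by near=> y; apply/esym; near: y; exact: H.
Unshelve. all: by end_near. Qed.

Section polynomial_itv.
Context (R : realType).
Local Notation lam := (@lebesgue_measure R).

Lemma integrable_poly_itv (q : {poly R}) (a b : R) :
  lam.-integrable `[a, b]%classic (EFin \o horner q).
Proof.
apply: continuous_compact_integrable; first exact: segment_compact.
apply: continuous_subspaceT => x.
apply: differentiable_continuous; apply/derivable1_diffP.
exact: derivable_horner.
Qed.

Lemma Rintegral_deriv_poly (q : {poly R}) (a b : R) : a < b ->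
  \int[lam]_(x in `[a, b]) q^`().[x] = q.[b] - q.[a].
Proof.
have cq (p : {poly R}) : continuous (horner p).
  move=> x; apply: differentiable_continuous; apply/derivable1_diffP.
  exact: derivable_horner.
move=> ab; rewrite /Rintegral (@continuous_FTC2 _ (horner q^`()) (horner q))//.
- by apply: continuous_subspaceT => x; exact: cq.
- split.
  + by move=> x _; exact: derivable_horner.
  + by apply: cvg_at_right_filter; exact: cq.
  + by apply: cvg_at_left_filter; exact: cq.
- by move=> x _; rewrite -derivE.
Qed.

End polynomial_itv.

Section slice.
Context (R : realType) (I : finType) (P : pred I) (tau : I -> R) (sgn : I -> bool).
Variables (S : set R).
Hypothesis S_bnd : exists L, forall t, S t -> `|t| <= L.
Hypothesis S_end : forall i, P i ->
  \forall t \near tau i, S t <-> if sgn i then t < tau i else tau i < t.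
Hypothesis S_loc : forall t, (forall i, P i -> t != tau i) ->
  \forall s \near t, S s <-> S t.
Hypothesis tau_inj : {in P &, injective tau}.

(* The half-lines are open at right ends of [S] and closed at left ends: with
   this convention [jump] below is locally constant at the ends too. *)
Let step i (t : R) : R := if sgn i then (t < tau i)%R%:R else - ((t <= tau i)%R%:R).

Let step_loc i (t : R) : tau i != t -> \forall s \near t, step i s = step i t.
Proof.
rewrite neq_lt /step => /orP[it|ti].
  have H := lt_nbhsr it; near=> s.
  have st : tau i < s by near: s.
  by rewrite (lt_gtF it) (lt_gtF st) (lt_geF it) (lt_geF st).
have H := lt_nbhsl ti; near=> s.
have st : s < tau i by near: s.
by rewrite ti st (ltW st) (ltW ti).
Unshelve. all: by end_near. Qed.

Let jump (t : R) : R := \1_S t - \sum_(i | P i) step i t.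

(** Away from the ends each term is locally constant. At [tau i] only the indicator of [S] and
    [step i] change, because the ends are distinct, and the two changes cancel. *)
Let jump_loc (t : R) : \forall s \near t, jump s = jump t.
Proof.
have [/existsP[i /andP[Pi /eqP ti]]|H] :=
    boolP [exists i, P i && (t == tau i)]; last first.
  have Ht i : P i -> t != tau i.
    by move=> Pi; move: H; rewrite negb_exists => /forallP/(_ i); rewrite Pi.
  have H1 : \forall s \near t, forall i, P i -> step i s = step i t.
    apply: (@filter_forall _ _
      (fun i => [set s | P i -> step i s = step i t]) (nbhs t) _) => i.
    have [Pi|nPi] := boolP (P i); last first.
      by apply: filterE => s.
    have := @step_loc i t; rewrite eq_sym Ht// => /(_ isT).
    by apply: filterS => s Hs _.
  near=> s; rewrite /jump; congr (_ - _).
    have ST : S s <-> S t by near: s; exact: S_loc.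
    rewrite !indicE; suff -> : (s \in S) = (t \in S) by [].
    by apply/idP/idP; rewrite !inE => /ST.
  by apply: eq_bigr => i Pi; apply: (near H1 s).
have H1 : \forall s \near t, forall j, P j && (j != i) -> step j s = step j t.
  apply: (@filter_forall _ _
    (fun j => [set s | P j && (j != i) -> step j s = step j t]) (nbhs t) _) => j.
  have [/andP[Pj ji]|nPj] := boolP (P j && (j != i)); last first.
    by apply: filterE => s.
  have tji : tau j != t.
    by rewrite ti; apply: contra ji => /eqP E; apply/eqP; exact: tau_inj E.
  by have := step_loc tji; apply: filterS => s Hs _.
have H2 := S_end Pi.
rewrite -ti in H2.
have St : S t <-> if sgn i then t < t else t < t by exact: (nbhs_singleton H2).
near=> s.
rewrite /jump (bigD1 i)//= (bigD1 i Pi)//= !opprD !addrA; congr (_ - _); last first.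
  by apply: eq_bigr => j Pj; apply: (near H1 s).
have Ss : S s <-> if sgn i then s < t else t < s by near: s.
have -> : \1_S s = (if sgn i then s < t else t < s)%R%:R :> R.
  by rewrite indicE; congr ((nat_of_bool _)%:R); apply/idP/idP; rewrite inE => /Ss.
have -> : \1_S t = (if sgn i then t < t else t < t)%R%:R :> R.
  by rewrite indicE; congr ((nat_of_bool _)%:R); apply/idP/idP; rewrite inE => /St.
rewrite /step -ti ltxx lexx; case: (sgn i); first by rewrite !subrr.
by rewrite !opprK add0r; case: ltgtP => _; rewrite /= ?mulr0n ?mulr1n ?addr0 ?add0r.
Unshelve. all: by end_near. Qed.

Lemma indic_slice (t : R) : \1_S t = \sum_(i | P i) step i t.
Proof.
apply/eqP; rewrite -subr_eq0 -/(jump t); apply/eqP.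
have [L HL] := S_bnd.
(* [b] lies to the right of [S] and of all ends, where the indicator and every [step] vanish. *)
pose b := `|L| + \sum_i `|tau i| + 1.
have bL : L < b.
  rewrite /b -addrA (le_lt_trans (ler_norm L))// ltrDl ltr_wpDl//.
  by apply: sumr_ge0.
have bt i : tau i < b.
  rewrite (le_lt_trans (ler_norm _))// /b (bigD1 i)//=.
  have h1 : 0 <= `|L| by [].
  have h2 : 0 <= \sum_(j | j != i) `|tau j| by apply: sumr_ge0.
  lra.
have b0 : 0 <= b by rewrite /b !addr_ge0// sumr_ge0.
rewrite (locally_cst jump_loc t b) /jump indicE memNset; last first.
  by move=> /HL; rewrite ger0_norm// leNgt bL.
rewrite big1 ?subr0// => i _; rewrite /step; case: ifP => _.
  by rewrite ltNge (ltW (bt i)).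
by rewrite leNgt bt oppr0.
Qed.

(** The half-lines are cut at a point [a] to the left of everything. Each one gives [q.[tau i] -
    q.[a]] with its sign, and the signs add up to zero, so the terms in [q.[a]] cancel. *)
Lemma integral_slice (q : {poly R}) :
  (\int[lebesgue_measure]_t (\1_S t * q^`().[t])%:E =
   (\sum_(i | P i) (if sgn i then 1 else -1) * q.[tau i])%:E)%E.
Proof.
have [L HL] := S_bnd.
pose a := - (`|L| + \sum_i `|tau i| + 1).
have aL t : S t -> a < t.
  move=> /HL tL; rewrite /a ltrNl (le_lt_trans (ler_norm _))// normrN.
  rewrite (le_lt_trans tL)// -addrA (le_lt_trans (ler_norm L))// ltrDl ltr_wpDl//.
  by apply: sumr_ge0.
have at_ i : a < tau i.
  rewrite /a ltrNl (le_lt_trans (ler_norm _))// normrN (bigD1 i)//=.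
  have h1 : 0 <= `|L| by [].
  have h2 : 0 <= \sum_(j | j != i) `|tau j| by apply: sumr_ge0.
  lra.
pose s i : R := if sgn i then 1 else -1.
pose J i : set R := if sgn i then `[a, tau i[%classic else `[a, tau i]%classic.
(* This is [indic_slice] at [a], which lies outside [S] and in every half-line. *)
have suma : \sum_(i | P i) s i = 0.
  have := indic_slice a; rewrite indicE memNset; last by move=> /aL; rewrite ltxx.
  move=> E; transitivity (\sum_(i | P i) step i a); last by rewrite -E.
  by apply: eq_bigr => i _; rewrite /s /step at_ (ltW (at_ i)).
have SE t : \1_S t = \sum_(i | P i) s i * \1_(J i) t.
  have [ta|at0] := ltP t a.
    rewrite indicE memNset; last by move=> /aL; rewrite ltNge (ltW ta).
    rewrite big1// => i _; rewrite indicE memNset ?mulr0// /J.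
    by case: (sgn i); rewrite /= in_itv /= leNgt ta.
  rewrite indic_slice; apply: eq_bigr => i _; rewrite /step /s /J indicE.
  have memJ (A : itv_bound R) : (t \in [set` Interval (BLeft a) A]%classic) =
      (t \in Interval (BLeft a) A).
    by apply/idP/idP => [/set_mem|/mem_set].
  by case: (sgn i); rewrite ?memJ in_itv /= at0 ?mul1r ?mulN1r.
have mJ i : measurable (J i : set (measurableTypeR R)) by rewrite /J; case: ifP.
have iJ' i : lebesgue_measure.-integrable (J i) (EFin \o horner q^`()).
  apply: (integrableS _ _ _ (integrable_poly_itv q^`() a (tau i)));
    [exact: measurable_itv|exact: mJ|].
  by rewrite /J; case: ifP => _ //; apply: subset_itvl; rewrite bnd_simp.
have restr : forall i : I,
    (fun t : R => \1_(J i) t * q^`().[t]) = (horner q^`()) \_ (J i).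
  by move=> i; apply/funext => t; rewrite patch_indic /= mulrC.
have hJ i : lebesgue_measure.-integrable setT (EFin \o (fun t => \1_(J i) t * q^`().[t])).
  rewrite restr -restrict_EFin.
  by have := iJ' i; rewrite integrable_mkcond//; exact: mJ.
have iJ i : lebesgue_measure.-integrable setT
    (EFin \o (fun t => s i * (\1_(J i) t * q^`().[t]))).
  by apply: (eq_integrable measurableT _ _ _ (integrableZl measurableT (s i) (hJ i))).
have [h1 h2] := @Rintegral_sum _ _ R lebesgue_measure setT I (index_enum I) P _
  measurableT (fun i _ => iJ i).
rewrite (eq_integral (fun t : measurableTypeR R =>
  (\sum_(i | P i) s i * (\1_(J i) t * q^`().[t]))%:E)); last first.
  by move=> t _; rewrite SE mulr_suml; congr EFin; apply: eq_bigr => i _; rewrite mulrA.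
rewrite -[LHS]fineK; last exact: integrable_fin_num h1.
congr EFin; rewrite [LHS]h2.
transitivity (\sum_(i | P i) (s i * q.[tau i] - s i * q.[a])); last first.
  by rewrite sumrB -mulr_suml suma mul0r subr0.
apply: eq_bigr => i _; rewrite -mulrBr.
rewrite RintegralZl//; congr (_ * _).
rewrite -(Rintegral_deriv_poly q (at_ i)).
transitivity (\int[lebesgue_measure]_(t in J i) q^`().[t]).
  by rewrite [RHS]Rintegral_mkcond restr.
have := iJ' i; rewrite /J; case: (sgn i) => // iJi.
by rewrite Rintegral_itv_bndo_bndc.
Qed.

End slice.

(** * The divergence theorem on a cell *)

Section frames.
Context (R : realType).

Definition affine_poly n p (C : 'M[R]_(n, p)) (c : 'rV[R]_p) (j : 'I_p) : mpoly n R :=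
  \sum_k C k j *: mvar R k + mpolyC n (c 0 j).

Lemma ev_affine_poly n p (C : 'M[R]_(n, p)) (c : 'rV[R]_p) j x :
  ev (affine_poly C c j) x = (x *m C + c) 0 j.
Proof.
rewrite evD evC ev_sum !mxE; congr (_ + _); apply: eq_bigr => k _.
by rewrite evZ ev_var mulrC.
Qed.

Lemma affine_continuous n p (C : 'M[R]_(n, p)) (c : 'rV[R]_p) :
  continuous (fun x : 'rV[R]_n => x *m C + c).
Proof.
move=> x V [W Wx WV].
have H : \forall y \near x, forall j, W 0 j ((y *m C + c) 0 j).
  apply: (@filter_forall _ _ (fun j => [set y | W 0 j ((y *m C + c) 0 j)]) (nbhs x) _) => j.
  have := @ev_continuous R n (affine_poly C c j) x (W 0 j).
  rewrite ev_affine_poly => /(_ (Wx 0 j)).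
  rewrite (_ : [set y | _] = ev (affine_poly C c j) @^-1` W 0 j)//.
  by apply/funext => y /=; rewrite ev_affine_poly.
by apply: filterS H => y Hy; apply: WV => i j; rewrite ord1; exact: Hy.
Qed.

Definition chart_poly d (b : 'rV[R]_d) (A : 'M[R]_(d.-1, d)) (p : mpoly d R) :
  mpoly d.-1 R := comp_mpoly [tuple affine_poly A b j | j < d] p.

Lemma ev_chart_poly d (b : 'rV[R]_d) (A : 'M[R]_(d.-1, d)) p y :
  ev (chart_poly b A p) y = ev p (chart b A y).
Proof.
rewrite /ev comp_mpoly_meval; apply: meval_eq => j.
by rewrite tnth_mktuple; rewrite -/(ev _ y) ev_affine_poly /chart addrC.
Qed.

(** The chart has a continuous affine left inverse [ret], and its range is closed, being the set of
    [w] fixed by [ret] followed by the chart. *)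
Lemma closure_chart d (b : 'rV[R]_d) (A : 'M[R]_(d.-1, d)) (Y : set 'rV[R]_d.-1) :
  A *m A^T = 1%:M -> closure (chart b A @` Y) `<=` chart b A @` closure Y.
Proof.
move=> AA x xY.
pose ret w := w *m A^T + (- (b *m A^T)).
have retK y : ret (chart b A y) = y.
  by rewrite /ret /chart mulmxDl -mulmxA AA mulmx1 addrAC subrr add0r.
have cret : continuous ret by exact: affine_continuous.
exists (ret x).
  move=> V Vx; have [_ [[y Yy <-] Vy]] := xY _ (cret x V Vx).
  by exists y; split => //; rewrite /= retK in Vy.
apply/rowP => j; apply/eqP; apply: contraT => xj.
(* [q] is coordinate [j] of [chart b A (ret w) - w]. It vanishes on the range of the chart, so it
   cannot be nonzero at a limit point of the range. *)
pose q := affine_poly (A^T *m A - 1%:M) (b - b *m A^T *m A) j.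
have Hq w : ev q w = (chart b A (ret w) - w) 0 j.
  rewrite ev_affine_poly; congr (fun_of_matrix _ _ _).
  rewrite /chart /ret mulmxBr mulmx1 mulmxDl mulNmx !mulmxA.
  set X := w *m _ *m _; set Z := b *m _ *m _.
  by rewrite addrACA [X + b]addrC [- w - Z]addrC !addrA.
have qx : nbhs x [set w | ev q w != 0].
  apply: (@ev_continuous R d q x [set y | y != 0]).
  apply: open_nbhs_nbhs; split; first exact: open_neq.
  by rewrite /= Hq mxE [X in _ + X]mxE subr_eq0.
have [_ [[y Yy <-]]] := xY _ qx.
by rewrite /= Hq retK subrr mxE eqxx.
Qed.

Lemma dotC n (x y : 'rV[R]_n) : dot x y = dot y x.
Proof. by apply: eq_bigr => i _; rewrite mulrC. Qed.

Lemma dotE n (x y : 'rV[R]_n) : dot x y = (x *m y^T) 0 0.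
Proof. by rewrite mxE; apply: eq_bigr => i _; rewrite !mxE. Qed.

Lemma dotDl n (x y z : 'rV[R]_n) : dot (x + y) z = dot x z + dot y z.
Proof. by rewrite !dotE mulmxDl mxE. Qed.

Lemma dotZl n c (x y : 'rV[R]_n) : dot (c *: x) y = c * dot x y.
Proof. by rewrite !dotE -scalemxAl mxE. Qed.

Lemma dot_delta n (i : 'I_n) (x : 'rV[R]_n) : dot (delta_mx 0 i) x = x 0 i.
Proof.
rewrite /dot (bigD1 i)//= !mxE !eqxx mul1r big1 ?addr0// => j ji.
by rewrite mxE (negbTE ji) andbF mul0r.
Qed.

Lemma enorm_delta n (i : 'I_n) (c : R) : enorm (c *: delta_mx 0 i : 'rV[R]_n) = `|c|.
Proof. by rewrite /enorm dotZl dot_delta !mxE !eqxx mulr1 -expr2 sqrtr_sqr. Qed.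

(** Stacking [nu] on [A] gives an orthogonal matrix [O], so its adjugate is [\det O *: O^T]. In row
    [i] and column 0 this reads, up to sign, as the minor of [A] without column [i]. The value is
    the ratio by which a facet shrinks when projected along direction [i]. *)
Lemma det_frame n (A : 'M[R]_(n, n.+1)) (nu : 'rV[R]_n.+1) (i : 'I_n.+1) :
  A *m A^T = 1%:M -> nu *m A^T = 0 -> dot nu nu = 1 ->
  `|\det (col' i A)| = `|nu 0 i|.
Proof.
move=> AA nA nn.
pose O : 'M[R]_(1 + n) := col_mx nu A.
have OO : O *m O^T = 1%:M.
  have An : A *m nu^T = 0 by rewrite -[LHS]trmxK trmx_mul trmxK nA trmx0.
  rewrite /O tr_col_mx mul_col_row AA nA An.
  by rewrite [nu *m _]mx11_scalar -dotE nn -scalar_mx_block.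
have dO : \det O * \det O = 1 by rewrite -{2}det_tr -det_mulmx OO det1.
have adjO : \adj O = \det O *: O^T.
  rewrite -[LHS]mulmx1 -OO mulmxA mul_adj_mx.
  by rewrite mul_scalar_mx.
have := congr1 (fun M : 'M[R]_(1 + n) => M i 0) adjO.
rewrite !mxE /cofactor => /(congr1 Num.norm); rewrite !normrM normrX normrN1 expr1n mul1r.
have nd : `|\det O| = 1.
  by apply/eqP; rewrite -sqrp_eq1// expr2 -normrM dO normr1.
rewrite nd mul1r => H.
have -> : \det (col' i A) = \det (row' 0 (col' i O)).
  congr (\det _); apply/matrixP => k j; rewrite !mxE.
  case: splitP => [l /=|l /=]; first by rewrite ord1.
  by rewrite /bump /= add1n add1n => -[kl]; congr (A _ _); apply/val_inj.
rewrite H; congr `|_|; case: splitP => [l /=|l //]; rewrite ?ord1//.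
Qed.

End frames.

Section divergence.
Context (R : realType) (n : nat) (n12 : n = 1%N \/ n = 2%N).
Local Notation mR := (measurableTypeR R).
Local Notation lam := (@lebesgue_measure R).
Variables (D : set 'rV[R]_n.+1) (I : finType) (P : pred I).
Variables (fc : I -> facet R n.+1) (nu : I -> 'rV[R]_n.+1).
Hypothesis oD : open D.
Hypothesis bD : bset D.
Hypothesis fc_open : forall e, P e -> open (f_dom (fc e)).
Hypothesis fc_bset : forall e, P e -> bset (f_dom (fc e)).
Hypothesis fc_faces : forall e, P e -> exists s : seq ('rV[R]_n * R),
  (forall p, p \in s -> p.1 != 0) /\
  (forall x, bdry (f_dom (fc e)) x -> exists2 p, p \in s & dot p.1 x = p.2).
Hypothesis fc_frame : forall e, P e -> orthoframe (f_frame (fc e)) (nu e).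
Hypothesis fc_disj : forall e e', P e -> P e' -> e != e' ->
  f_set (fc e) `&` f_set (fc e') = set0.
Hypothesis fc_bdry : forall x, bdry D x -> exists2 e, P e & closure (f_set (fc e)) x.
Hypothesis fc_out : forall e, P e -> forall x, f_set (fc e) x -> outward_normal D x (nu e).

Variable i : 'I_n.+1.

Let dm e : set 'rV[R]_n := f_dom (fc e).
Let ch e (y : 'rV[R]_n) : 'rV[R]_n.+1 := f_chart (fc e) y.
Let fr e : 'M[R]_(n, n.+1) := f_frame (fc e).
Let org e : 'rV[R]_n.+1 := f_org (fc e).
Let B e : 'M[R]_n := col' i (fr e).

(* [th e] is the inverse of the projection of the facet [e] along direction
   [i], in the coordinates of its chart. *)
Let th e := taffine (invmx (B e)) (- (col' i (org e) *m invmx (B e))).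
Let pt (z : n.-tuple mR) (s : mR) : 'rV[R]_n.+1 := tvec (tins i (s, z)).
(** For a facet [e] transversal to direction [i], [tau z e] is the position at which the line over
    [z] crosses its hyperplane; [hit z e] says that [e] is such a facet and contains the
    crossing. *)
Let tau z e : R := ch e (tvec (th e z)) 0 i.
Let hit z e := [&& P e, nu e 0 i != 0 & `[< dm e (tvec (th e z)) >]].

Let ptE z s : pt z s = pt z 0 + s *: delta_mx 0 i.
Proof.
apply/rowP => j; rewrite !mxE; case: (unliftP i j) => [k ->|->].
  by rewrite !tins_lift eq_sym (negbTE (neq_lift _ _)) andbF mulr0 addr0.
by rewrite !tinsE !eqxx mulr1 add0r.
Qed.

Let col'_pt z s : col' i (pt z s) = tvec z.
Proof. by apply/rowP => k; rewrite !mxE tins_lift. Qed.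

Let pt_i z s : pt z s 0 i = s.
Proof. by rewrite mxE tinsE. Qed.

Let ptP x z s : col' i x = tvec z -> x 0 i = s -> x = pt z s.
Proof.
move=> xz xs; apply/rowP => j; case: (unliftP i j) => [k ->|->].
  by have := congr1 (fun v : 'rV[R]_n => v 0 k) xz; rewrite !mxE tins_lift.
by rewrite xs pt_i.
Qed.

Let detB e : P e -> `|\det (B e)| = `|nu e 0 i|.
Proof. by move=> /fc_frame[h1 h2 h3]; exact: det_frame. Qed.

Let unitB e : P e -> nu e 0 i != 0 -> B e \in unitmx.
Proof. by move=> Pe n0; rewrite unitmxE unitfE -normr_eq0 detB// normr_eq0. Qed.

Let col'_ch e y : col' i (ch e y) = col' i (org e) + y *m B e.
Proof.
apply/rowP => k; rewrite !mxE; congr (_ + _); apply: eq_bigr => l _.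
by rewrite !mxE.
Qed.

Let thE e z : tvec (th e z) = (tvec z - col' i (org e)) *m invmx (B e).
Proof. by rewrite /th /taffine vtupK mulmxBl. Qed.

Let ch_th e z : P e -> nu e 0 i != 0 -> ch e (tvec (th e z)) = pt z (tau z e).
Proof.
move=> Pe n0; apply: ptP => //.
by rewrite col'_ch thE mulmxKV ?unitB// addrCA subrr addr0.
Qed.

Let th_ch e z y s : P e -> nu e 0 i != 0 -> ch e y = pt z s ->
  y = tvec (th e z) /\ s = tau z e.
Proof.
move=> Pe n0 ys.
have H : y = tvec (th e z).
  rewrite thE -(col'_pt z s) -ys col'_ch addrAC subrr add0r mulmxK//.
  exact: unitB.
by split => //; rewrite /tau -H ys pt_i.
Qed.

Let lscale_th e : P e -> nu e 0 i != 0 -> lscale (th e) `|nu e 0 i|.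
Proof.
move=> Pe n0; have dB : \det (invmx (B e)) != 0.
  by rewrite det_inv invr_eq0 -normr_eq0 detB// normr_eq0.
have := lscale_affine (- (col' i (org e) *m invmx (B e))) n12 dB.
by rewrite det_inv normrV ?invrK ?detB// unitfE -normr_eq0 detB// normr_eq0.
Qed.

(** A good line avoids the hyperplanes of the facets parallel to it and passes through no relative
    boundary point of a transversal facet. *)
Let good z := forall e, P e ->
  (nu e 0 i = 0 -> forall s, dot (pt z s) (nu e) <> dot (org e) (nu e)) /\
  (nu e 0 i != 0 -> ~ bdry (dm e) (tvec (th e z))).

Let dot_pt z s v : dot (pt z s) v = dot (col' i v) (tvec z) + s * v 0 i.
Proof.
rewrite /dot (bigD1_ord i)//= pt_i addrC; congr (_ + _).
by apply: eq_bigr => k _; rewrite !mxE tins_lift mulrC.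
Qed.

Let hyp_ae (p : 'rV[R]_n) c : p != 0 ->
  {ae leb R n, forall t, dot p (tvec t) <> c}.
Proof.
move=> p0; exists [set t | dot p (tvec t) = c]; split.
- exact: measurable_hyperplane.
- exact: hyperplane_null.
- by move=> t /= /contrapT.
Qed.

(** A facet parallel to direction [i] projects into a hyperplane with normal [col' i (nu e)],
    nonzero because [nu e] is a unit vector. For a transversal facet, the boundary of the chart
    domain lies in finitely many hyperplanes, and pulling them back by [th e] only scales measure.
    All these sets of [z] are null. *)
Let good_ae : {ae leb R n, forall z, good z}.
Proof.
apply: (@filter_forall _ _ (fun e => [set z | P e ->
  (nu e 0 i = 0 -> forall s, dot (pt z s) (nu e) <> dot (org e) (nu e)) /\
  (nu e 0 i != 0 -> ~ bdry (dm e) (tvec (th e z)))]) _ _) => e.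
have [Pe|nPe] := boolP (P e); last by apply: filterE => z.
have [n0|n0] := eqVneq (nu e 0 i) 0.
  have v0 : col' i (nu e) != 0.
    have [_ _ nn] := fc_frame Pe; apply/eqP => v0.
    have : dot (nu e) (nu e) = 0.
      rewrite {1}(_ : nu e = pt (vtup 0) 0) ?dot_pt ?v0 ?mul0r ?addr0.
        by rewrite /dot big1// => k _; rewrite mxE mul0r.
      by apply: ptP; rewrite ?vtupK.
    by move=> H; move/eqP: nn; rewrite H eq_sym oner_eq0.
  have := hyp_ae (dot (org e) (nu e)) v0; apply: filterS => z H _; split => // _ s.
  by rewrite dot_pt n0 mulr0 addr0.
have [s [s0 Hs]] := fc_faces Pe.
have [mth Hth] := lscale_th Pe n0.
have H : {ae leb R n, forall z, forall j : 'I_(size s),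
    dot (tnth (in_tuple s) j).1 (tvec (th e z)) <> (tnth (in_tuple s) j).2}.
  apply: (@filter_forall _ _ (fun j : 'I_(size s) =>
    [set z | dot (tnth (in_tuple s) j).1 (tvec (th e z)) <>
      (tnth (in_tuple s) j).2]) _ _) => j.
  set q := tnth _ j.
  exists (th e @^-1` [set t | dot q.1 (tvec t) = q.2]); split.
  - by rewrite -[X in measurable X]setTI; apply: mth => //; exact: measurable_hyperplane.
  - rewrite Hth; last exact: measurable_hyperplane.
    by rewrite hyperplane_null ?mule0// s0// mem_tnth.
  - by move=> t /= /contrapT.
apply: filterS H => z H _; split => [|_ /Hs[q qs]].
  by move=> E; rewrite E eqxx in n0.
have /tnthP[j ->] : q \in in_tuple s by [].
exact: H.
Qed.

Let pt_cont z : continuous (pt z : R -> 'rV[R]_n.+1).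
Proof.
move=> s V /rV_ballP[r r0 rV].
apply/nbhs_ballP; exists r => // t; rewrite /ball /= => st; apply: rV => j.
case: (unliftP i j) => [k ->|->].
  by rewrite !mxE !tins_lift subrr normr0.
by rewrite !pt_i.
Qed.

(** At a crossing inside a facet [D] is locally a half-space, and the sign of [nu e 0 i] tells on
    which side of [tau z e] the line is in [D]. *)
Let slice_end z e : good z -> hit z e ->
  \forall t \near tau z e, D (pt z t) <->
    if 0 < nu e 0 i then t < tau z e else tau z e < t.
Proof.
move=> _ /and3P[Pe n0 /asboolP De].
have /(fc_out Pe)[_ [r r0 Hr]] : f_set (fc e) (ch e (tvec (th e z))).
  by exists (tvec (th e z)).
rewrite ch_th// in Hr.
have : nbhs (tau z e) (ball (tau z e) r) by exact: nbhsx_ballx.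
apply: filterS => t; rewrite /ball /= => tr.
have E : pt z t - pt z (tau z e) = (t - tau z e) *: delta_mx 0 i.
  by rewrite ptE [in X in _ - X]ptE opprD addrACA subrr add0r scalerBl.
have := Hr (pt z t); rewrite E enorm_delta distrC => /(_ tr) ->.
rewrite dotZl dot_delta; have [nn|np|n00] := ltgtP (nu e 0 i) 0.
- by rewrite nmulr_llt0// subr_gt0.
- by rewrite pmulr_llt0// subr_lt0.
- by rewrite n00 eqxx in n0.
Qed.

(** Off the boundary this is openness of [D] and of the complement of its closure. A boundary point
    on a good line lies in the closure of a facet that is neither parallel to the line nor met on
    its relative boundary; the point is then a crossing, which is excluded. *)
Let slice_loc z t : good z -> (forall e, hit z e -> t != tau z e) ->
  \forall s \near t, D (pt z s) <-> D (pt z t).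
Proof.
move=> gz Ht; have [Dt|nDt] := pselect (D (pt z t)).
  have H : nbhs t (pt z @^-1` D) by apply: pt_cont; exact: open_nbhs_nbhs.
  by apply: filterS H => s Ds; split.
have [cDt|ncDt] := pselect (closure D (pt z t)); last first.
  have H : nbhs t (pt z @^-1` (~` closure D)).
    apply: pt_cont; apply: open_nbhs_nbhs; split => //.
    by apply: closed_openC; exact: closed_closure.
  by apply: filterS H => s Ds; split => // Ds'; case: Ds; exact: subset_closure.
exfalso.
have [] := @fc_bdry (pt z t).
  by split => //; rewrite (_ : D° = D)//; exact/interior_id.
move=> e Pe; have [AA nA nn] := fc_frame Pe.
move=> /(closure_chart AA)[y cy yt].
have [g1 g2] := gz e Pe.
have [n0|n0] := eqVneq (nu e 0 i) 0.
  apply: (g1 n0 t); rewrite -yt /chart dotDl [X in _ + X](_ : _ = 0) ?addr0//.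
  by rewrite dotC dotE trmx_mul mulmxA nA mul0mx mxE.
have [ythE ttau] := th_ch Pe n0 yt.
have De : dm e y.
  apply: contrapT => nDe; apply: (g2 n0); rewrite -ythE; split => //.
  by rewrite (_ : (dm e)° = dm e)//; apply/interior_id/fc_open.
have : hit z e by rewrite /hit Pe n0 -ythE; apply/asboolP.
by move=> /Ht; rewrite ttau eqxx.
Qed.

Let tau_inj z : {in hit z &, injective (tau z)}.
Proof.
move=> e e' /and3P[Pe n0 /asboolP De] /and3P[Pe' n0' /asboolP De'] tt.
apply/eqP; apply: contraT => ee'.
have := fc_disj Pe Pe' ee' => /seteqP[H _].
case: (H (pt z (tau z e))); split.
  by exists (tvec (th e z)) => //; exact: ch_th.
by rewrite tt; exists (tvec (th e' z)) => //; exact: ch_th.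
Qed.

Variable p : mpoly n.+1 R.

Let G e (t : n.-tuple mR) : R := \1_(tset (dm e)) t * ev p (ch e (tvec t)).

(** The facets that are hit depend on [z]. The indicator inside [G] turns the sum into one over all
    transversal facets, which can be integrated over [z] term by term. *)
Let integral_good z : good z ->
  (\int[lam]_s (\1_(tset D) (tins i (s, z)) * ev (mderiv i p) (pt z s))%:E =
   (\sum_(e | P e && (nu e 0 i != 0))
      (if (0 < nu e 0 i)%R then 1 else -1) * G e (th e z))%:E)%E.
Proof.
move=> gz; have [q Hq] := ev_line p i (pt z 0).
have Hq' s : ev p (pt z s) = q.[s] /\ ev (mderiv i p) (pt z s) = q^`().[s].
  by rewrite ptE; exact: Hq.
have Sb : exists L, forall t, (fun s => D (pt z s)) t -> `|t| <= L.
  by have [r Hr] := bD; exists r => t /Hr/(_ i); rewrite pt_i.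
have := @integral_slice R I (hit z) (tau z) (fun e => 0 < nu e 0 i)
  (fun s => D (pt z s)) Sb (fun e he => slice_end gz he)
  (fun t Ht => slice_loc gz Ht) (@tau_inj z) q.
move=> H; transitivity (\int[lam]_t (\1_(fun s : R => D (pt z s)) t * q^`().[t])%:E)%E.
  apply: eq_integral => s _; by rewrite (Hq' s).2.
rewrite H; congr EFin; rewrite [RHS](bigID (fun e => `[< dm e (tvec (th e z)) >]))/=.
rewrite [X in _ = _ + X]big1 ?addr0 => [|e /andP[/andP[Pe n0] nDe]]; last first.
  rewrite /G indicE memNset ?mul0r ?mulr0// => dmz.
  by case/asboolP: nDe.
apply: eq_big => [e|e /and3P[Pe n0 De]]; first by rewrite /hit andbA.
rewrite /G indicE mem_set ?mul1r; last exact/asboolP.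
by rewrite ch_th// (Hq' _).1.
Qed.

Let integrable_G e : P e -> (leb R n).-integrable setT (EFin \o G e).
Proof.
move=> Pe; have mdm := open_tuple_measurable (fc_open Pe).
have := @intg_ev R n (dm e) (chart_poly (org e) (fr e) p) (fc_open Pe) (fc_bset Pe).
rewrite /intg integrable_mkcond//; congr (is_true (integrable _ _ _)).
rewrite restrict_EFin; congr (EFin \o _); apply/funext => t.
by rewrite patch_indic /G /= (@ev_chart_poly R n.+1) mulrC.
Qed.

Let integral_G e : P e ->
  (\int[leb R n]_t (G e t)%:E = (integ (dm e) (fun y => ev p (ch e y)))%:E)%E.
Proof.
move=> Pe; rewrite -[LHS]fineK; last exact: integrable_fin_num (integrable_G Pe).
congr EFin; rewrite /integ [RHS]Rintegral_mkcond; congr fine.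
by apply: eq_integral => t _; rewrite patch_indic /G mulrC.
Qed.

Lemma divergence_coord :
  integ D (ev (mderiv i p)) =
  \sum_(e | P e) nu e 0 i * integ (f_dom (fc e)) (fun y => ev p (f_chart (fc e) y)).
Proof.
have mD := open_tuple_measurable oD.
pose F t : R := \1_(tset D) t * ev (mderiv i p) (tvec t).
have FE : F = (fun t : n.+1.-tuple mR => ev (mderiv i p) (tvec t)) \_ (tset D).
  by apply/funext => t; rewrite patch_indic /F /= mulrC.
have iF : (leb R n.+1).-integrable setT (EFin \o F).
  have := @intg_ev R n.+1 D (mderiv i p) oD bD.
  by rewrite /intg integrable_mkcond// FE restrict_EFin.
have [mfub fub] := fubini_tins i iF.
have -> : integ D (ev (mderiv i p)) = fine (\int[leb R n.+1]_t (EFin \o F) t)%E.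
  by rewrite /integ Rintegral_mkcond -FE.
rewrite fub.
pose sg e : R := if 0 < nu e 0 i then 1 else -1.
(* The sign [sg e] times the factor [|nu e 0 i|] of the change of variables [th e] is [nu e 0 i]. *)
have tr e : P e -> nu e 0 i != 0 ->
    (leb R n).-integrable setT (EFin \o (fun z => sg e * G e (th e z))) /\
    \int[leb R n]_z (sg e * G e (th e z)) =
      nu e 0 i * integ (dm e) (fun y => ev p (ch e y)).
  move=> Pe n0; have [mth Hth] := lscale_th Pe n0.
  have [h1 h2] := @integral_transfer _ _ _ _ R (leb R n) (leb R n) (th e) _ _
    mth (normr_ge0 _) Hth (integrable_G Pe).
  have h3 : (leb R n).-integrable setT (EFin \o (fun z => G e (th e z))) by [].
  split; first by apply: (eq_integrable measurableT _ _ _ (integrableZl measurableT (sg e) h3)).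
  rewrite RintegralZl// /Rintegral h2 integral_G//= mulrA; congr (_ * _).
  rewrite /sg; have [nn|np|n00] := ltgtP (nu e 0 i) 0.
  - by rewrite mulN1r ltr0_norm ?opprK.
  - by rewrite mul1r gtr0_norm.
  - by rewrite n00 eqxx in n0.
have [h1 h2] := @Rintegral_sum _ _ R (leb R n) setT I (index_enum I)
  (fun e => P e && (nu e 0 i != 0)) (fun e z => sg e * G e (th e z)) measurableT
  (fun e Pe => (tr e (andP Pe).1 (andP Pe).2).1).
transitivity (\int[leb R n]_z
    (\sum_(e | P e && (nu e 0 i != 0)) sg e * G e (th e z))).
  congr fine; apply: ae_eq_integral => //; first exact: measurable_int h1.
  have := good_ae; apply: filterS => z gz _; exact: integral_good gz.
(* The facets parallel to direction [i] are absent on the left and carry the factor [nu e 0 i = 0]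
   on the right. *)
rewrite h2 [RHS](bigID (fun e => nu e 0 i == 0))/= [X in _ = X + _]big1 ?add0r.
  by apply: eq_bigr => e /andP[Pe n0]; exact: (tr e Pe n0).2.
by move=> e /andP[_ /eqP ->]; rewrite mul0r.
Qed.

End divergence.

(** * Geometry of polytopal cells and of the mesh *)

Section polytopes.
Context (R : realType) (n : nat).
Implicit Types (D : set 'rV[R]_n).

Lemma polytopal_bset D : polytopal D -> bset D.
Proof.
move=> hD; have [r Hr] := polytopal_bounded hD; exists r => x /Hr xr i.
apply: le_trans xr; rewrite -sqrtr_sqr /enorm; apply: ler_wsqrtr.
rewrite /dot (bigD1 i)//= -expr2 lerDl sumr_ge0// => j _.
by rewrite -expr2 sqr_ge0.
Qed.

Lemma diam_gt0 D : (0 < n)%N -> open D -> D !=set0 -> bset D -> 0 < diam D.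
Proof.
move=> n0 oD [x Dx] [r Hr].
have /rV_ballP[e e0 eD] : nbhs x D by exact: open_nbhs_nbhs.
pose i := Ordinal n0.
have Dy : D (x - (e / 2) *: delta_mx 0 i).
  have e2 : 0 <= e / 2 by rewrite divr_ge0 ?ltW.
  apply: eD => j; rewrite !mxE opprB addrC subrK normrM ger0_norm//.
  apply: (@le_lt_trans _ _ (e / 2)); last by rewrite ltr_pdivrMr// ltr_pMr// ltr1n.
  by rewrite ler_piMr//; case: (_ && _); rewrite ?normr1 ?normr0.
apply: (@lt_le_trans _ _ (e / 2)); first by rewrite divr_gt0.
apply: ub_le_sup; last first.
  exists x, (x - (e / 2) *: delta_mx 0 i); split => //.
  by rewrite opprB addrC subrK enorm_delta gtr0_norm// divr_gt0.
(* An upper bound for the distances, without which [sup] would say nothing: coordinates are at most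
   [r] in absolute value, so their differences are at most [r + r]. *)
exists (Num.sqrt (\sum_(j < n) (r + r) ^+ 2)) => _ [y [z [Dy' Dz ->]]].
apply: ler_wsqrtr; apply: ler_sum => j _; rewrite !mxE -expr2.
rewrite -[X in X <= _]real_normK ?num_real// lerXn2r ?nnegrE//.
  by rewrite addr_ge0// (le_trans _ (Hr _ Dx i)).
by rewrite (le_trans (ler_normB _ _))// lerD// Hr.
Qed.

End polytopes.

Section mesh_lemmas.
Context (R : realType) (d : nat) (Omega : set 'rV[R]_d) (M : mesh Omega).
Implicit Types (T : elt M) (e : edge M).

Lemma cell_open T : open (cell T). Proof. exact: polytopal_open (mesh_cell T). Qed.
Lemma cell_bset T : bset (cell T). Proof. exact: polytopal_bset (mesh_cell T). Qed.
Lemma cell_nonempty T : cell T !=set0.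
Proof. exact: polytopal_nonempty (mesh_cell T). Qed.
Lemma dom_open e : open (f_dom (fac e)).
Proof. exact: polytopal_open (mesh_facet e).1. Qed.
Lemma dom_bset e : bset (f_dom (fac e)).
Proof. exact: polytopal_bset (mesh_facet e).1. Qed.
Lemma dom_nonempty e : f_dom (fac e) !=set0.
Proof. exact: polytopal_nonempty (mesh_facet e).1. Qed.

(** A cell is open and contained in the closure of [Omega], whose interior is [Omega] by regularity.
    This gives access on cells to data known on [Omega]. *)
Lemma cell_sub T : polytopal Omega -> cell T `<=` Omega.
Proof.
move=> hO x Tx; have := polytopal_regular hO => /seteqP[H _]; apply: H.
have : cell T `<=` (closure Omega)°.
  rewrite -open_subsetE; last exact: cell_open.
  move=> y Ty; rewrite (mesh_cover M); exists T => //; exact: subset_closure.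
exact.
Qed.

Lemma cell_normal_sgn T e :
  cell_normal T e = f_nor (fac e) \/ cell_normal T e = - f_nor (fac e).
Proof. by rewrite /cell_normal; case: ifP; [left|right]. Qed.

Lemma cell_normal_unit T e : dot (cell_normal T e) (cell_normal T e) = 1.
Proof.
have [_ [_ _ nn]] := mesh_facet e; have [->|->] := cell_normal_sgn T e => //.
by rewrite -scaleN1r dotZl dotC dotZl mulN1r mulN1r opprK.
Qed.

Lemma cell_orthoframe T e : orthoframe (f_frame (fac e)) (cell_normal T e).
Proof.
have [_ [AA nA nn]] := mesh_facet e; split => //; last exact: cell_normal_unit.
by have [->|->] := cell_normal_sgn T e; rewrite ?mulNmx nA ?oppr0.
Qed.

Lemma cell_outward T e x : edge_of T e -> eset e x ->
  outward_normal (cell T) x (cell_normal T e).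
Proof.
move=> /asboolP Te xe; rewrite /cell_normal; case: asboolP => [|H]; first exact.
by have [H'|H'] := mesh_side Te; [case: H|exact: H'].
Qed.

End mesh_lemmas.
Arguments cell_open {R d Omega M} T.
Arguments cell_bset {R d Omega M} T.
Arguments cell_nonempty {R d Omega M} T.
Arguments dom_open {R d Omega M} e.
Arguments dom_bset {R d Omega M} e.
Arguments dom_nonempty {R d Omega M} e.

Lemma mesh_divergence (R : realType) (d : nat) (hd : d = 2%N \/ d = 3%N)
    (Omega : set 'rV[R]_d) (M : mesh Omega) (T : elt M) (p : mpoly d R) (i : 'I_d) :
  integ (cell T) (ev (mderiv i p)) =
  \sum_(e | edge_of T e) cell_normal T e 0 i * integ (f_dom (fac e)) (tr p e).
Proof.
(* Slicing asks for the dimension as a successor, so that the dimension [d.-1] of the charts reduces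
   to [n]. *)
suff go n : n = 1%N \/ n = 2%N -> d = n.+1 ->
  integ (cell T) (ev (mderiv i p)) =
  \sum_(e | edge_of T e) cell_normal T e 0 i * integ (f_dom (fac e)) (tr p e).
  by case: hd => E; [apply: (go 1%N)|apply: (go 2%N)] => //; [left|right].
move=> n12 E; clear hd; subst d.
refine (@divergence_coord R n n12 (cell T) (edge M) (fun e => edge_of T e)
  (fun e => fac e) (cell_normal T) _ _ _ _ _ _ _ _ _ i p).
- exact: cell_open.
- exact: cell_bset.
- by move=> e _; exact: dom_open.
- by move=> e _; exact: dom_bset.
- by move=> e _; exact: polytopal_faces (mesh_facet e).1.
- by move=> e _; exact: cell_orthoframe.
- by move=> e e' _ _; exact: mesh_edge_disj.
- move=> x; rewrite mesh_bdry => -[e He xe]; exists e => //; exact/asboolP.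
- by move=> e Te x; exact: cell_outward.
Qed.

(** * The scheme in terms of polynomials *)

(** The Fredholm alternative for a square system: a row lies in the row space of [G] as soon as it
    annihilates the kernel, which is tested on the columns of [cokermx]. Since [G] may be singular,
    a spanning family will do in place of a basis. *)
Lemma gram_solve (F : fieldType) (I : finType) (G : I -> I -> F) (l : I -> F) :
  (forall x : I -> F, (forall i, \sum_j G i j * x j = 0) ->
    \sum_i l i * x i = 0) ->
  exists c : I -> F, forall i, \sum_j c j * G j i = l i.
Proof.
move=> H.
have bij (f : I -> F) : \sum_i f i = \sum_(k < #|I|) f (enum_val k).
  by rewrite (reindex (fun k : 'I_#|I| => enum_val k))//=; apply: onW_bij; exact: enum_val_bij.
pose A : 'M[F]_#|I| := \matrix_(i, j) G (enum_val i) (enum_val j).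
pose L : 'rV[F]_#|I| := \row_i l (enum_val i).
have : (L <= A)%MS.
  rewrite submxE; apply/eqP/rowP => k; rewrite mxE [RHS]mxE.
  pose x i := cokermx A (enum_rank i) k.
  transitivity (\sum_i l i * x i).
    by rewrite bij; apply: eq_bigr => j _; rewrite /x enum_valK mxE.
  apply: H => i; rewrite bij.
  have := congr1 (fun M : 'M[F]_#|I| => M (enum_rank i) k) (mulmx_coker A).
  rewrite !mxE => E; rewrite -[RHS]E; apply: eq_bigr => j _.
  by rewrite /x enum_valK [A _ _]mxE enum_rankK.
case/submxP => C LC; exists (fun i => C 0 (enum_rank i)) => i; rewrite bij.
have := congr1 (fun M : 'rV[F]_#|I| => M 0 (enum_rank i)) LC.
rewrite !mxE enum_rankK => ->; apply: eq_bigr => j _.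
by rewrite enum_valK mxE enum_rankK.
Qed.

Section mpoly_linear.
Context (R : realType).

Lemma laplacian_linear d : linear (@laplacian R d).
Proof.
move=> a u v; rewrite /laplacian scaler_sumr -big_split/=.
by apply: eq_bigr => i _; rewrite !(mderivD, mderivZ).
Qed.
HB.instance Definition _ d := GRing.isLinear.Build R (mpoly d R) (mpoly d R) *:%R
  (@laplacian R d) (@laplacian_linear d).

Lemma nderiv_linear d nu : linear (@nderiv R d nu).
Proof.
move=> a u v; rewrite /nderiv scaler_sumr -big_split/=.
apply: eq_bigr => i _; rewrite mderivD mderivZ scalerDr; congr (_ + _).
by rewrite !scalerA mulrC.
Qed.
HB.instance Definition _ d nu := GRing.isLinear.Build R (mpoly d R) (mpoly d R) *:%R
  (@nderiv R d nu) (@nderiv_linear d nu).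

Lemma chart_poly_linear d b A : linear (@chart_poly R d b A).
Proof. by move=> a u v; rewrite /chart_poly comp_mpolyD comp_mpolyZ. Qed.
HB.instance Definition _ d b A := GRing.isLinear.Build R (mpoly d R) (mpoly d.-1 R) *:%R
  (@chart_poly R d b A) (@chart_poly_linear d b A).

Definition monb n m (j : bmultinom n m.+1) : mpoly n R := mpolyX R (bmnm j).

Lemma PolE n m (p : mpoly n R) : Pol m p ->
  p = \sum_(j : bmultinom n m.+1) mcoeff (bmnm j) p *: monb j.
Proof. exact: mpolywE. Qed.

Lemma Pol_monb n m (j : bmultinom n m.+1) : Pol m (monb j).
Proof. by rewrite /Pol /mkset /monb msizeX bmdeg. Qed.

Lemma Pol0 n m : Pol m (0 : mpoly n R).
Proof. by rewrite /Pol /mkset msize0. Qed.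

Lemma PolD n m (p q : mpoly n R) : Pol m p -> Pol m q -> Pol m (p + q).
Proof.
by move=> Pp Pq; rewrite /Pol /mkset (leq_trans (msizeD_le _ _))// geq_max; apply/andP.
Qed.

Lemma PolZ n m c (p : mpoly n R) : Pol m p -> Pol m (c *: p).
Proof. by move=> Pp; rewrite /Pol /mkset (leq_trans (msizeZ_le _ _)). Qed.

Lemma Pol_sum n m (I : Type) (s : seq I) (P : pred I) (F : I -> mpoly n R) :
  (forall i, P i -> Pol m (F i)) -> Pol m (\sum_(i <- s | P i) F i).
Proof.
by move=> H; elim/big_ind : _ => //; [exact: Pol0|move=> p q; exact: PolD].
Qed.

Lemma Pol_laplacian n m (p : mpoly n R) : Pol m p -> Pol m (laplacian p).
Proof.
move=> Pp; apply: Pol_sum => i _; rewrite /Pol /mkset.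
by apply/msize_mderiv/leqW/msize_mderiv/leqW.
Qed.

Lemma helmholtz_eq0 n (k : R) (p : mpoly n R) : k != 0 ->
  laplacian p + k *: p = 0 -> p = 0.
Proof.
move=> k0 H; apply/eqP; apply: contraT => p0.
have pE : p = - k^-1 *: laplacian p.
  rewrite (_ : laplacian p = - (k *: p)); last by apply/eqP; rewrite -addr_eq0 H.
  by rewrite scalerN scaleNr opprK scalerA mulVf// scale1r.
have [s sE] : exists s, msize p = s.+1.
  by case E : (msize p) => [|s]; [move/eqP: E; rewrite msize_poly_eq0 (negbTE p0)|exists s].
have : (msize p <= s)%N.
  rewrite pE (leq_trans (msizeZ_le _ _))//.
  rewrite (leq_trans (msize_sum _ _ _))//; apply/bigmax_leqP => i _.
  by apply/msize_mderiv/leqW/msize_mderiv; rewrite sE.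
by rewrite sE ltnn.
Qed.

Lemma integ_ev_linear n (D : set 'rV[R]_n) : open D -> bset D ->
  linear_for *%R (fun p : mpoly n R => integ D (ev p) : R).
Proof.
move=> oD bD a u v.
rewrite (integ_eq (G := fun x => a * ev u x + ev v x)); last first.
  by move=> x _; rewrite evD evZ.
by rewrite integD ?integZ//; [exact: intg_ev|exact/intgZ/intg_ev|exact: intg_ev].
Qed.

End mpoly_linear.

Section scheme_algebra.
Context (R : realType) (d : nat) (Omega : set 'rV[R]_d) (M : mesh Omega).
Implicit Types (T : elt M) (e : edge M) (u v : wfun M).

(** With integrals as linear forms on polynomials, identities between the forms of the scheme become
    algebra. *)
Definition cint T (p : mpoly d R) : R := integ (cell T) (ev p).
Definition eint e (p : mpoly d.-1 R) : R := integ (f_dom (fac e)) (ev p).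

Lemma cint_linear T : linear_for *%R (cint T).
Proof. by move=> a u v; rewrite /cint (integ_ev_linear (cell_open T) (cell_bset T)). Qed.
HB.instance Definition _ T :=
  GRing.isLinear.Build R (mpoly d R) R *%R (cint T) (cint_linear T).

Lemma eint_linear e : linear_for *%R (eint e).
Proof. by move=> a u v; rewrite /eint (integ_ev_linear (dom_open e) (dom_bset e)). Qed.
HB.instance Definition _ e :=
  GRing.isLinear.Build R (mpoly d.-1 R) R *%R (eint e) (eint_linear e).

Lemma cint_sqr_ge0 T p : 0 <= cint T (p * p).
Proof. by apply: integ_ge0 => x _; rewrite evM -expr2 sqr_ge0. Qed.

Lemma eint_sqr_ge0 e p : 0 <= eint e (p * p).
Proof. by apply: integ_ge0 => x _; rewrite evM -expr2 sqr_ge0. Qed.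

Lemma cint_sqr_eq0 T p : cint T (p * p) = 0 -> p = 0.
Proof.
move=> H; apply: (integ_sqr_eq0 (cell_open T) (cell_bset T) (cell_nonempty T)).
by rewrite -[RHS]H; apply: integ_eq => x _; rewrite evM.
Qed.

Lemma eint_sqr_eq0 e p : eint e (p * p) = 0 -> p = 0.
Proof.
move=> H; apply: (integ_sqr_eq0 (dom_open e) (dom_bset e) (dom_nonempty e)).
by rewrite -[RHS]H; apply: integ_eq => x _; rewrite evM.
Qed.

Definition trp e (p : mpoly d R) : mpoly d.-1 R :=
  chart_poly (f_org (fac e)) (f_frame (fac e)) p.

HB.instance Definition _ e := GRing.Linear.copy (trp e)
  (chart_poly (f_org (fac e)) (f_frame (fac e))).

Lemma ev_trp e p y : ev (trp e p) y = tr p e y.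
Proof. exact: ev_chart_poly. Qed.

(** The right-hand side in the definition of the weak Laplacian, as a linear form in the test
    polynomial [w]. *)
Definition wlf v T (w : mpoly d R) : R :=
  cint T (w0 v T * laplacian w)
  - \sum_(e | edge_of T e) eint e (wb v T e * trp e (nderiv (cell_normal T e) w))
  + \sum_(e | edge_of T e) eint e (ncomp (cell_normal T e) (wg v T e) * trp e w).

Lemma is_weak_laplacianP m v T q : is_weak_laplacian m v T q <->
  Pol m q /\ forall w, Pol m w -> cint T (q * w) = wlf v T w.
Proof.
have cE p1 p2 : ipT T (ev p1) (ev p2) = cint T (p1 * p2).
  by apply: integ_eq => x _; rewrite evM.
have wE w : wlf v T w = ipT T (ev (w0 v T)) (ev (laplacian w))
      - ipdT T (vbt v T) (ntr T w) + ipdT T (vgt v T) (tr w).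
  rewrite cE; congr (_ - _ + _); apply: eq_bigr => e _; apply: integ_eq => x _;
  by rewrite evM ev_trp.
by split=> -[Pq H]; split=> // w /H; rewrite -cE wE.
Qed.

Lemma wlf_linear v T : linear_for *%R (wlf v T).
Proof.
move=> a x y.
pose f1 w := cint T (w0 v T * laplacian w).
pose f2 e w := eint e (wb v T e * trp e (nderiv (cell_normal T e) w)).
pose f3 e w := eint e (ncomp (cell_normal T e) (wg v T e) * trp e w).
have f1L : f1 (a *: x + y) = a * f1 x + f1 y.
  by rewrite /f1 linearP mulrDr -scalerAr linearP.
have f2L e : f2 e (a *: x + y) = a * f2 e x + f2 e y.
  by rewrite /f2 !linearP mulrDr -scalerAr linearP.
have f3L e : f3 e (a *: x + y) = a * f3 e x + f3 e y.
  by rewrite /f3 linearP mulrDr -scalerAr linearP.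
have E w : wlf v T w = f1 w - \sum_(e | edge_of T e) f2 e w
  + \sum_(e | edge_of T e) f3 e w by [].
clearbody f1 f2 f3; rewrite !E f1L.
under eq_bigr do rewrite f2L; under [X in _ + X]eq_bigr do rewrite f3L.
rewrite !big_split /= -!mulr_sumr; ring.
Qed.
HB.instance Definition _ v T :=
  GRing.isLinear.Build R (mpoly d R) R *%R (wlf v T) (wlf_linear v T).

(** Gram system of the monomials: a kernel vector gives a polynomial [p] with [cint T (p * p) = 0],
    so [p = 0] and [wlf] vanishes on it. Hence [xget] in [weak_laplacian] never falls back on its
    default value. *)
Lemma weak_laplacian_exists m v T : exists q, is_weak_laplacian m v T q.
Proof.
pose G (i j : bmultinom d m.+1) := cint T (monb R i * monb R j).
have [x Gx|c Hc] := @gram_solve R _ G (fun i : bmultinom d m.+1 => wlf v T (monb R i)).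
  pose p := \sum_(j : bmultinom d m.+1) x j *: monb R j.
  have ip (i : bmultinom d m.+1) : cint T (monb R i * p) = 0.
    rewrite -[RHS](Gx i) mulr_sumr linear_sum; apply: eq_bigr => j _.
    by rewrite -scalerAr linearZ /= mulrC.
  have p0 : p = 0.
    apply: (@cint_sqr_eq0 T); rewrite {1}/p mulr_suml linear_sum big1// => i _.
    by rewrite -scalerAl linearZ /= ip mulr0.
  rewrite -[RHS](linear0 (wlf v T)) -p0 linear_sum; apply: eq_bigr => j _.
  by rewrite linearZ mulrC.
exists (\sum_(j : bmultinom d m.+1) c j *: monb R j); apply/is_weak_laplacianP; split.
  by apply: Pol_sum => j _; apply: PolZ; exact: Pol_monb.
move=> w /PolE ->; rewrite mulr_sumr !linear_sum; apply: eq_bigr => i _.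
rewrite -scalerAr !linearZ /= -Hc mulr_suml linear_sum; congr (_ * _).
by apply: eq_bigr => j _; rewrite -scalerAl linearZ.
Qed.

Lemma weak_laplacianP m v T : is_weak_laplacian m v T (weak_laplacian m v T).
Proof. by apply: xgetPex; exact: weak_laplacian_exists. Qed.

Lemma weak_laplacian_unique m v T q : is_weak_laplacian m v T q ->
  weak_laplacian m v T = q.
Proof.
move=> /is_weak_laplacianP[Pq Hq].
have /is_weak_laplacianP[Pl Hl] := weak_laplacianP m v T.
apply/eqP; rewrite -subr_eq0; apply/eqP/(@cint_sqr_eq0 T).
have PB : Pol m (weak_laplacian m v T - q) by rewrite -scaleN1r; apply: PolD => //; exact: PolZ.
by rewrite mulrBl linearB /= Hl ?Hq ?subrr.
Qed.

(** Linear combinations over a finite index type are all the linear structure that is put on the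
    bare record [wfun]; sums, differences and the zero function are instances. *)
Definition wsum (I : finType) (c : I -> R) (v : I -> wfun M) : wfun M :=
  WFun (fun T => \sum_i c i *: w0 (v i) T) (fun T e => \sum_i c i *: wb (v i) T e)
    (fun T e j => \sum_i c i *: wg (v i) T e j).

Lemma ncomp_sum (I : finType) (c : I -> R) (nu : 'rV[R]_d)
    (q : I -> 'I_d -> mpoly d.-1 R) :
  ncomp nu (fun j => \sum_i c i *: q i j) = \sum_i c i *: ncomp nu (q i).
Proof.
rewrite /ncomp; under eq_bigr do rewrite scaler_sumr.
rewrite exchange_big; apply: eq_bigr => i _; rewrite scaler_sumr.
by apply: eq_bigr => j _; rewrite !scalerA mulrC.
Qed.

Lemma wlf_sum (I : finType) (c : I -> R) (v : I -> wfun M) T w :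
  wlf (wsum c v) T w = \sum_i c i * wlf (v i) T w.
Proof.
pose f1 i := cint T (w0 (v i) T * laplacian w).
pose f2 i e := eint e (wb (v i) T e * trp e (nderiv (cell_normal T e) w)).
pose f3 i e := eint e (ncomp (cell_normal T e) (wg (v i) T e) * trp e w).
transitivity (\sum_i c i * f1 i - \sum_(e | edge_of T e) \sum_i c i * f2 i e
  + \sum_(e | edge_of T e) \sum_i c i * f3 i e).
  rewrite /wlf /= mulr_suml linear_sum; congr (_ - _ + _).
  - by apply: eq_bigr => i _; rewrite -scalerAl linearZ.
  - apply: eq_bigr => e _; rewrite mulr_suml linear_sum; apply: eq_bigr => i _.
    by rewrite -scalerAl linearZ.
  - apply: eq_bigr => e _; rewrite ncomp_sum mulr_suml linear_sum.
    by apply: eq_bigr => i _; rewrite -scalerAl linearZ.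
have E i : wlf (v i) T w = f1 i - \sum_(e | edge_of T e) f2 i e
  + \sum_(e | edge_of T e) f3 i e by [].
clearbody f1 f2 f3; under [RHS]eq_bigr do rewrite E mulrDr mulrBr !mulr_sumr.
by rewrite big_split sumrB /=; congr (_ - _ + _); exact: exchange_big.
Qed.

Lemma weak_laplacian_sum m (I : finType) (c : I -> R) (v : I -> wfun M) T :
  weak_laplacian m (wsum c v) T = \sum_i c i *: weak_laplacian m (v i) T.
Proof.
have H i := (is_weak_laplacianP m (v i) T _).1 (weak_laplacianP m (v i) T).
apply: weak_laplacian_unique; apply/is_weak_laplacianP; split.
  by apply: Pol_sum => i _; apply: PolZ; have [] := H i.
move=> w Pw; rewrite wlf_sum mulr_suml linear_sum; apply: eq_bigr => i _.
by rewrite -scalerAl linearZ /=; have [_ ->] := H i.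
Qed.

Definition resp m k v T : mpoly d R := weak_laplacian m v T + k ^+ 2 *: w0 v T.

Lemma resp_sum m k (I : finType) (c : I -> R) (v : I -> wfun M) T :
  resp m k (wsum c v) T = \sum_i c i *: resp m k (v i) T.
Proof.
rewrite /resp weak_laplacian_sum /= scaler_sumr -big_split; apply: eq_bigr => i _.
by rewrite /= scalerDr !scalerA mulrC.
Qed.

Lemma ev_resp m k v T x : ev (resp m k v T) x = wres m k v T x.
Proof. by rewrite evD evZ. Qed.

(** The differences in the stabilizer are kept as polynomials in the chart of [e], so that a zero
    integral of their square makes them identically zero. *)
Definition jumpb v T e : mpoly d.-1 R := trp e (w0 v T) - wb v T e.
Definition jumpg v T e : mpoly d.-1 R :=
  trp e (nderiv (cell_normal T e) (w0 v T)) - ncomp (cell_normal T e) (wg v T e).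

Lemma jumpb_sum (I : finType) (c : I -> R) (v : I -> wfun M) T e :
  jumpb (wsum c v) T e = \sum_i c i *: jumpb (v i) T e.
Proof.
rewrite /jumpb /= linear_sum -sumrB; apply: eq_bigr => i _.
by rewrite linearZ scalerBr.
Qed.

Lemma jumpg_sum (I : finType) (c : I -> R) (v : I -> wfun M) T e :
  jumpg (wsum c v) T e = \sum_i c i *: jumpg (v i) T e.
Proof.
rewrite /jumpg /= ncomp_sum [nderiv _ _]linear_sum [trp _ _]linear_sum -sumrB.
apply: eq_bigr => i _.
rewrite scalerBr; congr (_ - _); rewrite linearZ; exact: linearZ.
Qed.

Definition jumpb_form u v T : R :=
  \sum_(e | edge_of T e) eint e (jumpb u T e * jumpb v T e).

Definition jumpg_form u v T : R :=
  \sum_(e | edge_of T e) eint e (jumpg u T e * jumpg v T e).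

Definition localform m k u v T : R :=
  cint T (resp m k u T * resp m k v T) +
  (k ^+ 2 * diam (cell T) ^- 3 * jumpb_form u v T
   + k ^+ 2 * (diam (cell T))^-1 * jumpg_form u v T).

Lemma wgformE m k u v : Defs.form m k u v = \sum_T localform m k u v T.
Proof.
rewrite /Defs.form /stab -big_split; apply: eq_bigr => T _.
congr (_ + (_ * _ + _ * _)).
- by apply: integ_eq => x _; rewrite evM !ev_resp.
- by apply: eq_bigr => e _; apply: integ_eq => x _; rewrite evM !evB !ev_trp.
- by apply: eq_bigr => e _; apply: integ_eq => x _; rewrite evM !evB !ev_trp.
Qed.

Lemma jumpb_formC u v T : jumpb_form u v T = jumpb_form v u T.
Proof. by apply: eq_bigr => e _; rewrite mulrC. Qed.

Lemma jumpg_formC u v T : jumpg_form u v T = jumpg_form v u T.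
Proof. by apply: eq_bigr => e _; rewrite mulrC. Qed.

Lemma wgformC m k u v : Defs.form m k u v = Defs.form m k v u.
Proof.
rewrite !wgformE; apply: eq_bigr => T _.
by rewrite /localform mulrC (jumpb_formC u) (jumpg_formC u).
Qed.

Lemma jumpb_form_suml (I : finType) (c : I -> R) (v : I -> wfun M) w T :
  jumpb_form (wsum c v) w T = \sum_i c i * jumpb_form (v i) w T.
Proof.
under [RHS]eq_bigr do rewrite mulr_sumr.
rewrite exchange_big; apply: eq_bigr => e _.
rewrite jumpb_sum mulr_suml linear_sum; apply: eq_bigr => i _.
by rewrite -scalerAl linearZ.
Qed.

Lemma jumpg_form_suml (I : finType) (c : I -> R) (v : I -> wfun M) w T :
  jumpg_form (wsum c v) w T = \sum_i c i * jumpg_form (v i) w T.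
Proof.
under [RHS]eq_bigr do rewrite mulr_sumr.
rewrite exchange_big; apply: eq_bigr => e _.
rewrite jumpg_sum mulr_suml linear_sum; apply: eq_bigr => i _.
by rewrite -scalerAl linearZ.
Qed.

Lemma wgform_suml m k (I : finType) (c : I -> R) (v : I -> wfun M) w :
  Defs.form m k (wsum c v) w = \sum_i c i * Defs.form m k (v i) w.
Proof.
have L T : localform m k (wsum c v) w T = \sum_i c i * localform m k (v i) w T.
  have rE : cint T (resp m k (wsum c v) T * resp m k w T) =
      \sum_i c i * cint T (resp m k (v i) T * resp m k w T).
    rewrite resp_sum mulr_suml linear_sum; apply: eq_bigr => i _.
    by rewrite -scalerAl linearZ.
  rewrite /localform rE jumpb_form_suml jumpg_form_suml.
  rewrite !mulr_sumr -!big_split; apply: eq_bigr => i _ /=.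
  by rewrite !mulrDr; congr (_ + (_ + _)); rewrite mulrCA.
rewrite wgformE; under eq_bigr do rewrite L.
by rewrite exchange_big; apply: eq_bigr => i _; rewrite wgformE mulr_sumr.
Qed.

End scheme_algebra.

(** * Green's formula and definiteness of the form *)

Section scheme_green.
Context (R : realType) (d : nat) (hd : d = 2%N \/ d = 3%N)
  (Omega : set 'rV[R]_d) (M : mesh Omega).
Implicit Types (T : elt M) (e : edge M) (u v : wfun M).

Lemma trpM e (p q : mpoly d R) : trp e (p * q) = trp e p * trp e q.
Proof. by rewrite /trp /chart_poly rmorphM. Qed.

Lemma eint_trp e (p : mpoly d R) : eint e (trp e p) = integ (f_dom (fac e)) (tr p e).
Proof. by apply: integ_eq => y _; rewrite ev_trp. Qed.

(** Divergence theorem for the field with components [p * mderiv i w - mderiv i p * w], whose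
    divergence is [p * laplacian w - laplacian p * w]. The right-hand side is arranged to match
    [wlf], with the traces of [p] as edge components. *)
Lemma green T (p w : mpoly d R) :
  cint T (laplacian p * w) =
  cint T (p * laplacian w)
  - \sum_(e | edge_of T e) eint e (trp e p * trp e (nderiv (cell_normal T e) w))
  + \sum_(e | edge_of T e) eint e (trp e (nderiv (cell_normal T e) p) * trp e w).
Proof.
have E (x y z t : R) : x - y = z - t -> y = x - z + t by move=> ?; lra.
pose F i := p * mderiv i w - mderiv i p * w.
have HF : \sum_i cint T (mderiv i (F i)) = cint T (p * laplacian w) - cint T (laplacian p * w).
  rewrite -linearB /laplacian mulr_sumr mulr_suml -sumrB linear_sum.
  apply: eq_bigr => i _; congr (cint T _); rewrite /F mderivB !mderivM.
  ring.
have HE : \sum_i cint T (mderiv i (F i)) =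
    \sum_(e | edge_of T e) (eint e (trp e p * trp e (nderiv (cell_normal T e) w))
      - eint e (trp e (nderiv (cell_normal T e) p) * trp e w)).
  under eq_bigr => i _ do rewrite /cint (mesh_divergence hd).
  rewrite exchange_big; apply: eq_bigr => e _.
  rewrite -linearB -!trpM -linearB /=.
  rewrite {1}/nderiv {1}/nderiv mulr_sumr mulr_suml -sumrB.
  rewrite [trp e _]linear_sum [eint e _]linear_sum.
  apply: eq_bigr => i _; rewrite -eint_trp.
  rewrite -scalerAr -scalerAl -scalerBr; apply/esym; rewrite linearZ; exact: linearZ.
have := etrans (esym HF) HE; rewrite sumrB => H.
exact: E H.
Qed.

End scheme_green.

Section scheme_definite.
Context (R : realType) (d : nat) (hd : d = 2%N \/ d = 3%N)
  (Omega : set 'rV[R]_d) (M : mesh Omega) (m : nat) (k : R) (k0 : 0 < k).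
Implicit Types (T : elt M) (e : edge M) (u v : wfun M).

Lemma ncomp_cell_normal T e (q : 'I_d -> mpoly d.-1 R) :
  (ncomp (cell_normal T e) q == 0) = (ncomp (f_nor (fac e)) q == 0).
Proof.
have [->//|->] := cell_normal_sgn T e.
rewrite (_ : ncomp _ q = - ncomp (f_nor (fac e)) q) ?oppr_eq0//.
by rewrite /ncomp -sumrN; apply: eq_bigr => i _; rewrite mxE scaleNr.
Qed.

Lemma cell_diam_gt0 T : 0 < diam (cell T).
Proof.
apply: diam_gt0; [by case: hd => ->|exact: cell_open|exact: cell_nonempty|exact: cell_bset].
Qed.

Lemma wgform_definite v : (forall T, in_Wloc m v T) -> Defs.form m k v v = 0 ->
  forall T, w0 v T = 0 /\ forall e, edge_of T e ->
    wb v T e = 0 /\ ncomp (f_nor (fac e)) (wg v T e) = 0.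
Proof.
move=> Wv v0 T.
have kk : 0 < k ^+ 2 by rewrite exprn_gt0.
have c2 T' : 0 < k ^+ 2 * diam (cell T') ^- 3.
  by rewrite mulr_gt0// invr_gt0 exprn_gt0// cell_diam_gt0.
have c3 T' : 0 < k ^+ 2 * (diam (cell T'))^-1.
  by rewrite mulr_gt0// invr_gt0 cell_diam_gt0.
have sb T' : 0 <= jumpb_form v v T'.
  by apply: sumr_ge0 => e _; exact: eint_sqr_ge0.
have sg T' : 0 <= jumpg_form v v T'.
  by apply: sumr_ge0 => e _; exact: eint_sqr_ge0.
have sbg T' := addr_ge0 (mulr_ge0 (ltW (c2 T')) (sb T')) (mulr_ge0 (ltW (c3 T')) (sg T')).
(* All terms are nonnegative, and the weights are positive since cells have positive diameter; so
   each term vanishes on each cell. *)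
have : localform m k v v T = 0.
  have l0 T' : true -> 0 <= localform m k v v T'.
    by move=> _; apply: addr_ge0; [exact: cint_sqr_ge0|exact: sbg].
  by apply: (psumr_eq0P l0) => //; rewrite -wgformE.
move/eqP; rewrite paddr_eq0 ?cint_sqr_ge0 ?sbg// => /andP[/eqP r0].
rewrite paddr_eq0 ?(mulr_ge0 (ltW (c2 T)) (sb T)) ?(mulr_ge0 (ltW (c3 T)) (sg T))//.
rewrite (mulf_eq0 _ (jumpb_form _ _ _)) (gt_eqF (c2 T)).
rewrite (mulf_eq0 _ (jumpg_form _ _ _)) (gt_eqF (c3 T)) /=.
move=> /andP[/eqP b0 /eqP g0].
have jb e : edge_of T e -> trp e (w0 v T) = wb v T e.
  move=> Te; apply/eqP; rewrite -subr_eq0; apply/eqP/(@eint_sqr_eq0 _ _ _ _ e).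
  by have := psumr_eq0P (fun e _ => eint_sqr_ge0 e (jumpb v T e)) b0; apply.
have jg e : edge_of T e ->
    trp e (nderiv (cell_normal T e) (w0 v T)) = ncomp (cell_normal T e) (wg v T e).
  move=> Te; apply/eqP; rewrite -subr_eq0; apply/eqP/(@eint_sqr_eq0 _ _ _ _ e).
  by have := psumr_eq0P (fun e _ => eint_sqr_ge0 e (jumpg v T e)) g0; apply.
(* With the traces identified, [wlf] is the right-hand side of [green]. As [laplacian (w0 v T)] has
   degree at most [m], uniqueness makes it the weak Laplacian. *)
have wl : weak_laplacian m v T = laplacian (w0 v T).
  apply: weak_laplacian_unique; apply/is_weak_laplacianP; split.
    by apply: Pol_laplacian; have [] := Wv T.
  move=> w _; rewrite (green hd) /wlf; congr (_ - _ + _).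
  - by apply: eq_bigr => e Te; rewrite jb.
  - by apply: eq_bigr => e Te; rewrite jg.
have w00 : w0 v T = 0.
  apply: (@helmholtz_eq0 _ _ (k ^+ 2)); first by rewrite gt_eqF.
  by rewrite -wl; exact: cint_sqr_eq0 r0.
split=> // e Te; split; first by rewrite -jb// w00 linear0.
by apply/eqP; rewrite -(ncomp_cell_normal T) -jg// w00 !linear0.
Qed.

End scheme_definite.

(** On a bounded set [p] is bounded, and [|f|] is at most [1 + f ^+ 2], which is integrable
    there. *)
Lemma intg_L2 (R : realType) n (Omega D : set 'rV[R]_n)
    (f : 'rV[R]_n -> R) (p : mpoly n R) :
  open Omega -> open D -> bset D -> D `<=` Omega -> L2 Omega f ->
  intg D (fun x => f x * ev p x).
Proof.
have aux (a : R) : a <= 1 + a ^+ 2 by nra.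
move=> oO oD bD sub [mf f2].
have mD := open_tuple_measurable oD; have mO := open_tuple_measurable oO.
have msub : tset D `<=` tset Omega by move=> t /sub.
have mfD := measurable_funS mO msub mf.
have [C HC] := ev_bounded p bD.
have C0 : 0 <= `|C| by [].
have i1 : (leb R n).-integrable (tset D) (EFin \o (fun=> 1 : R)).
  have := @intg_bounded R n D (fun=> 1) oD bD; apply; first exact: measurable_cst.
  by exists 1 => x _; rewrite normr1.
have i2 : (leb R n).-integrable (tset D) (EFin \o (fun t => f (tvec t) ^+ 2)).
  apply/integrableP; split; first by apply/measurable_EFinP; exact: measurable_funX.
  apply: le_lt_trans f2; rewrite (eq_integral (fun t => (f (tvec t) ^+ 2)%:E)); last first.
    by move=> t _; rewrite /= ger0_norm ?sqr_ge0.
  apply: ge0_subset_integral => //.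
    by apply/measurable_EFinP; exact: measurable_funX.
  by move=> t _; rewrite lee_fin sqr_ge0.
apply: (le_integrable mD _ _ (integrableZl mD `|C| (integrableD mD i1 i2))).
  by apply/measurable_EFinP/measurable_funM => //; exact: ev_measurable.
move=> t Dt /=; rewrite lee_fin normrM [leRHS]ger0_norm; last first.
  by rewrite mulr_ge0// addr_ge0// sqr_ge0.
rewrite mulrC ler_pM//; first by rewrite (le_trans (HC _ Dt))// ler_norm.
by rewrite -[f (tvec t) ^+ 2]real_normK ?num_real.
Qed.

(** * A finite spanning family of weak functions modulo [weq] *)

Section weak_functions.
Context (R : realType) (d : nat) (Omega : set 'rV[R]_d) (M : mesh Omega)
  (m : nat) (k : R) (f : 'rV[R]_d -> R).
Implicit Types (T : elt M) (e : edge M) (u v w : wfun M).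
Hypothesis hOmega : polytopal Omega.
Hypothesis hf : L2 Omega f.

Definition load v : R := \sum_T ipT T f (wres m k v T).

Lemma load_sum (I : finType) (c : I -> R) (v : I -> wfun M) :
  load (wsum c v) = \sum_i c i * load (v i).
Proof.
rewrite /load; under [RHS]eq_bigr do rewrite mulr_sumr.
rewrite exchange_big; apply: eq_bigr => T _.
have iT i : intg (cell T) (fun x => f x * ev (resp m k (v i) T) x).
  exact: intg_L2 (polytopal_open hOmega) (cell_open T) (cell_bset T) (cell_sub hOmega) hf.
have [_ S] := integ_sum (index_enum I) c (cell_open T) iT.
transitivity (\sum_i c i * integ (cell T) (fun x => f x * ev (resp m k (v i) T) x)).
  rewrite -S; apply: integ_eq => x _; rewrite -ev_resp resp_sum ev_sum mulr_sumr.
  by apply: eq_bigr => i _; rewrite evZ mulrCA.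
by apply: eq_bigr => i _; congr (_ * _); apply: integ_eq => x _; rewrite ev_resp.
Qed.

Lemma weq_ncomp u v T e : weq u v -> edge_of T e ->
  ncomp (cell_normal T e) (wg u T e) = ncomp (cell_normal T e) (wg v T e).
Proof.
move=> /(_ T)[_ H] /H[_ E]; have [->//|->] := cell_normal_sgn T e.
have N q : ncomp (- f_nor (fac e)) q = - ncomp (f_nor (fac e)) q.
  by rewrite /ncomp -sumrN; apply: eq_bigr => i _; rewrite mxE scaleNr.
by rewrite !N E.
Qed.

Lemma weq_wlf u v T q : weq u v -> wlf u T q = wlf v T q.
Proof.
move=> uv; have [w0E H] := uv T.
have bE : \sum_(e | edge_of T e)
    eint e (wb u T e * trp e (nderiv (cell_normal T e) q)) =
  \sum_(e | edge_of T e) eint e (wb v T e * trp e (nderiv (cell_normal T e) q)).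
  by apply: eq_bigr => e Te; have [-> _] := H e Te.
have gE : \sum_(e | edge_of T e)
    eint e (ncomp (cell_normal T e) (wg u T e) * trp e q) =
  \sum_(e | edge_of T e) eint e (ncomp (cell_normal T e) (wg v T e) * trp e q).
  by apply: eq_bigr => e Te; rewrite (weq_ncomp uv Te).
rewrite /wlf w0E.
exact: (congr2 (fun a b => cint T (w0 v T * laplacian q) - a + b) bE gE).
Qed.

Lemma weq_resp u v T : weq u v -> resp m k u T = resp m k v T.
Proof.
move=> uv; have wlE : weak_laplacian m u T = weak_laplacian m v T.
  apply: weak_laplacian_unique; apply/is_weak_laplacianP.
  have /is_weak_laplacianP[Pq Hq] := weak_laplacianP m v T.
  by split => // q Pq'; rewrite (weq_wlf T q uv); exact: Hq.
by rewrite /resp wlE; have [-> _] := uv T.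
Qed.

Lemma weq_form u v w : weq u v -> Defs.form m k u w = Defs.form m k v w.
Proof.
move=> uv; rewrite !wgformE; apply: eq_bigr => T _; have [w0E H] := uv T.
have bE : jumpb_form u w T = jumpb_form v w T.
  by apply: eq_bigr => e Te; rewrite /jumpb w0E; have [-> _] := H e Te.
have gE : jumpg_form u w T = jumpg_form v w T.
  by apply: eq_bigr => e Te; rewrite /jumpg w0E (weq_ncomp uv Te).
by rewrite /localform (weq_resp T uv) bE gE.
Qed.

Lemma weq_load u v : weq u v -> load u = load v.
Proof.
move=> uv; apply: eq_bigr => T _; apply: integ_eq => x _.
by rewrite -!ev_resp (weq_resp T uv).
Qed.

Lemma in_W_sum (I : finType) (c : I -> R) (v : I -> wfun M) :
  (forall i, in_W m (v i)) -> in_W m (wsum c v).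
Proof.
move=> H; split.
  move=> T; split; first by apply: Pol_sum => i _; apply: PolZ; have [/(_ T)[]] := H i.
  move=> e Te; split.
    by apply: Pol_sum => i _; apply: PolZ; have [/(_ T)[_ /(_ e Te)[]]] := H i.
  by move=> j; apply: Pol_sum => i _; apply: PolZ; have [/(_ T)[_ /(_ e Te)[]]] := H i.
move=> e ie T T' Te Te'; rewrite /= !ncomp_sum.
by split; apply: eq_bigr => i _;
  have [_ /(_ e ie T T' Te Te')[E1 E2]] := H i; rewrite ?E1 ?E2.
Qed.

Variable G1 : set 'rV[R]_d.

Lemma in_W0_sum (I : finType) (c : I -> R) (v : I -> wfun M) :
  (forall i, in_W0 m G1 (v i)) -> in_W0 m G1 (wsum c v).
Proof.
move=> H; split; first by apply: in_W_sum => i; have [] := H i.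
move=> T e Te eG; rewrite /= ncomp_sum.
by split; rewrite big1// => i _;
  have [_ /(_ T e Te eG)[E1 E2]] := H i; rewrite ?E1 ?E2 scaler0.
Qed.

Definition on_G1 e : bool := `[< eset e `<=` G1 >].

(* A cell chosen to carry the value on [e]: the same one for all the cells
   sharing [e] when [e] is interior, the given cell otherwise. *)
Definition carrier T e : elt M :=
  if `[< interior_edge e >] then odflt T [pick T' | edge_of T' e] else T.

Lemma edge_of_carrier T e : edge_of T e -> edge_of (carrier T e) e.
Proof. by move=> Te; rewrite /carrier; case: ifP => // _; case: pickP. Qed.

Lemma carrier_interior T T' e : interior_edge e -> edge_of T e ->
  carrier T e = carrier T' e.
Proof.
move=> ie Te; rewrite /carrier; case: ifP => [_|/asboolP//].
by case: pickP => // /(_ T); rewrite Te.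
Qed.

(** Turns unconstrained polynomial data into a member of [in_W0]: zero on the edges in [G1],
    elsewhere read at the carrier so as to be single-valued on interior edges, with a purely normal
    third component. *)
Definition embed (p0 : elt M -> mpoly d R)
    (pb pg : elt M * edge M -> mpoly d.-1 R) : wfun M :=
  WFun p0 (fun T e => if on_G1 e then 0 else pb (carrier T e, e))
    (fun T e i => if on_G1 e then 0 else f_nor (fac e) 0 i *: pg (carrier T e, e)).

Lemma ncomp_scale (nu : 'rV[R]_d) (q : mpoly d.-1 R) : dot nu nu = 1 ->
  ncomp nu (fun i => nu 0 i *: q) = q.
Proof.
move=> nn; rewrite /ncomp; under eq_bigr do rewrite scalerA.
by rewrite -scaler_suml -/(dot nu nu) nn scale1r.
Qed.

Lemma ncomp0 (nu : 'rV[R]_d) : ncomp nu (fun=> 0 : mpoly d.-1 R) = 0.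
Proof. by rewrite /ncomp big1// => i _; rewrite scaler0. Qed.

Lemma ncomp_embed p0 pb pg T e :
  ncomp (f_nor (fac e)) (wg (embed p0 pb pg) T e) =
  if on_G1 e then 0 else pg (carrier T e, e).
Proof.
rewrite /=; case: (on_G1 e); first exact: ncomp0.
by rewrite ncomp_scale//; have [_ []] := mesh_facet e.
Qed.

Lemma embed_W0 p0 pb pg : (forall T, Pol m (p0 T)) -> (forall x, Pol m (pb x)) ->
  (forall x, Pol m.-1 (pg x)) -> in_W0 m G1 (embed p0 pb pg).
Proof.
move=> H0 Hb Hg; split; first split.
- move=> T; split => // e Te; split => /=.
    by case: ifP => _; [exact: Pol0|exact: Hb].
  by move=> i; case: ifP => _; [exact: Pol0|exact: PolZ].
- move=> e ie T T' Te Te'; rewrite !ncomp_embed /=.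
  by rewrite (carrier_interior T' ie Te).
- move=> T e Te eG; have eG' : on_G1 e by exact/asboolP.
  by rewrite /= eG'; split => //; exact: ncomp0.
Qed.

(** A component that is single-valued may be read at the carrier. Tangential parts are lost, so the
    equality is only [weq]. *)
Lemma weq_embed v : in_W0 m G1 v ->
  weq v (embed (w0 v) (fun x => wb v x.1 x.2)
    (fun x => ncomp (f_nor (fac x.2)) (wg v x.1 x.2))).
Proof.
move=> [[_ vi] vG] T; split => // e Te; rewrite ncomp_embed /=.
case: ifPn => [/asboolP eG|_].
  have [-> /eqP H] := vG T e Te eG; split => //.
  by apply/eqP; rewrite -(ncomp_cell_normal T).
rewrite /carrier; case: asboolP => [ie|//].
case: pickP => [T' T'e|//]; exact: vi.
Qed.

(** One generator per monomial on each cell, and per monomial of either kind on each pair of a cell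
    and an edge. The family is merely spanning: a pair that is not incident, for instance, gives a
    generator equivalent to zero. *)
Definition weak_basis_index : finType :=
  ((elt M * bmultinom d m.+1) + ((elt M * edge M) * bmultinom d.-1 m.+1 +
    (elt M * edge M) * bmultinom d.-1 m.-1.+1))%type.

Definition spike (X : finType) n j (i : X * bmultinom n j.+1) (x : X) : mpoly n R :=
  if x == i.1 then monb R i.2 else 0.

Lemma Pol_spike (X : finType) n j (i : X * bmultinom n j.+1) x : Pol j (spike i x).
Proof. by rewrite /spike; case: ifP => _; [exact: Pol_monb|exact: Pol0]. Qed.

Lemma sum_spike (X : finType) n j (p : X -> mpoly n R) (x : X) : Pol j (p x) ->
  \sum_(i : X * bmultinom n j.+1) mcoeff (bmnm i.2) (p i.1) *: spike i x = p x.
Proof.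
move=> Pp; rewrite -(pair_bigA _ (fun y l => mcoeff (bmnm l) (p y) *: spike (y, l) x))/=.
rewrite (bigD1 x)//= [X in _ + X]big1 ?addr0 => [|y yx]; last first.
  by rewrite big1// => l _; rewrite /spike /= eq_sym (negbTE yx) scaler0.
by rewrite [RHS](PolE Pp); apply: eq_bigr => l _; rewrite /spike eqxx.
Qed.

Definition weak_basis (i : weak_basis_index) : wfun M :=
  match i with
  | inl a => embed (spike a) (fun=> 0) (fun=> 0)
  | inr (inl a) => embed (fun=> 0) (spike a) (fun=> 0)
  | inr (inr a) => embed (fun=> 0) (fun=> 0) (spike a)
  end.

Definition coords v (i : weak_basis_index) : R :=
  match i with
  | inl a => mcoeff (bmnm a.2) (w0 v a.1)
  | inr (inl a) => mcoeff (bmnm a.2) (wb v a.1.1 a.1.2)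
  | inr (inr a) => mcoeff (bmnm a.2) (ncomp (f_nor (fac a.1.2)) (wg v a.1.1 a.1.2))
  end.

Lemma weak_basis_W0 i : in_W0 m G1 (weak_basis i).
Proof.
by case: i => [a|[a|a]]; apply: embed_W0 => *; solve [exact: Pol_spike|exact: Pol0].
Qed.

Lemma weq_trans u v w : weq u v -> weq v w -> weq u w.
Proof.
move=> uv vw T; have [a1 a2] := uv T; have [b1 b2] := vw T.
split; first by rewrite a1.
by move=> e Te; have [-> ->] := a2 e Te; exact: b2.
Qed.

Lemma weq_weak_basis v : in_W0 m G1 v -> weq v (wsum (coords v) weak_basis).
Proof.
move=> Wv; apply: weq_trans (weq_embed Wv) _ => T.
have [[Wl _] _] := Wv.
split.
  rewrite /= !big_sumType /= [X in _ + (X + _)]big1 ?[X in _ + (_ + X)]big1 ?addr0.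
  - by rewrite (sum_spike (p := w0 v))//; have [] := Wl T.
  - by move=> i _; rewrite scaler0.
  - by move=> i _; rewrite scaler0.
move=> e Te; rewrite ncomp_embed /= ncomp_sum; split.
  rewrite /= !big_sumType /= [X in X + _]big1 ?[X in _ + (_ + X)]big1 ?addr0 ?add0r.
  - case: (on_G1 e); first by rewrite big1// => i _; rewrite scaler0.
    rewrite (sum_spike (p := fun x => wb v x.1 x.2))//=.
    by have [_ /(_ e (edge_of_carrier Te))[]] := Wl (carrier T e).
  - by move=> i _; case: ifP; rewrite scaler0.
  - by move=> i _; case: ifP; rewrite scaler0.
have N i : ncomp (f_nor (fac e)) (wg (weak_basis i) T e) = if on_G1 e then 0 else
    if i is inr (inr a) then spike a (carrier T e, e) else 0.
  by case: i => [a|[a|a]]; exact: ncomp_embed.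
under [RHS]eq_bigr do rewrite N.
case: (on_G1 e); first by rewrite big1// => i _; rewrite scaler0.
rewrite !big_sumType /= [X in X + _]big1 ?[X in _ + (X + _)]big1 ?add0r.
- rewrite (sum_spike (p := fun x => ncomp (f_nor (fac x.2)) (wg v x.1 x.2)))//=.
  have [_ /(_ e (edge_of_carrier Te))[_ H]] := Wl (carrier T e).
  by apply: Pol_sum => i _; exact: PolZ.
- by move=> i _; rewrite scaler0.
- by move=> i _; rewrite scaler0.
Qed.

End weak_functions.

(** * Existence and uniqueness *)

Section existence.
Context (R : realType) (d : nat) (hd : d = 2%N \/ d = 3%N)
  (Omega G1 : set 'rV[R]_d) (M : mesh Omega) (m : nat) (k : R) (k0 : 0 < k)
  (f : 'rV[R]_d -> R).
Implicit Types (T : elt M) (e : edge M) (u v w : wfun M).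
Hypothesis hOmega : polytopal Omega.
Hypothesis hf : L2 Omega f.
Hypothesis hG1 : G1 `<=` bdry Omega.

Let F v w := Defs.form m k v w.
Let l v := load m k f v.
(** An empty combination, so that the form and the load vanish on it by linearity. *)
Let zero : wfun M := wsum (fun i : 'I_0 => 0 : R) (fun=>
  WFun (fun=> 0) (fun _ _ => 0) (fun _ _ _ => 0)).

Let F_zero w : F zero w = 0.
Proof. by rewrite /F wgform_suml big_ord0. Qed.

Let l_zero : l zero = 0.
Proof. by rewrite /l load_sum// big_ord0. Qed.

Let weq_zero v : in_W m v -> F v v = 0 -> weq v zero.
Proof.
move=> [Wl _] Fv T; have [w00 H] := wgform_definite hd k0 Wl Fv T.
split; first by rewrite /= big_ord0.
by move=> e /H[-> ->]; rewrite /= ncomp_sum !big_ord0.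
Qed.

(** [gram_solve] over the generators. A kernel vector gives [v] with [F v v = 0], so [v] is zero up
    to [weq] by definiteness, and the right-hand side [l - F u0] kills it. Equality tested on the
    generators extends to every [w], because both sides depend on [w] linearly and only up to
    [weq]. *)
Lemma variational_exists u0 : exists v, in_W0 m G1 v /\
  forall w, in_W0 m G1 w -> F u0 w + F v w = l w.
Proof.
pose b := @weak_basis R d Omega M m G1.
have [x Hx|c Hc] := @gram_solve R _ (fun i j => F (b i) (b j))
  (fun i => l (b i) - F u0 (b i)).
  pose v := wsum x b.
  have Fbv i : F (b i) v = 0.
    rewrite /F wgformC wgform_suml -[RHS](Hx i); apply: eq_bigr => j _.
    by rewrite wgformC mulrC.
  have v0 : weq v zero.
    apply: weq_zero; first by have [] := in_W0_sum x (@weak_basis_W0 R d Omega M m G1).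
    by rewrite /F {1}/v wgform_suml big1// => i _; rewrite -/(F _ _) Fbv mulr0.
  have : l v - F u0 v = 0.
    rewrite /l (weq_load _ _ _ v0) -/(l _) l_zero /F wgformC (weq_form _ _ _ v0).
    by rewrite -/(F _ _) F_zero subrr.
  rewrite /l /v load_sum// /F wgformC wgform_suml -sumrB => E; rewrite -[RHS]E.
  by apply: eq_bigr => i _; rewrite mulrC mulrBr wgformC.
exists (wsum c b); split; first exact/in_W0_sum/weak_basis_W0.
move=> w Ww; have ww := weq_weak_basis Ww.
have Fw u : F u w = \sum_i coords w i * F u (b i).
  rewrite /F wgformC (weq_form _ _ _ ww) wgform_suml.
  by apply: eq_bigr => i _; rewrite wgformC.
rewrite /l (weq_load _ _ _ ww) load_sum// !Fw -big_split /=.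
apply: eq_bigr => i _; rewrite -mulrDr; congr (_ * _).
by rewrite /F wgform_suml Hc addrC subrK.
Qed.

Lemma variational_unique v : in_W0 m G1 v ->
  (forall w, in_W0 m G1 w -> F v w = 0) -> weq v zero.
Proof. by move=> Wv H; apply: weq_zero (H v Wv); have [] := Wv. Qed.

Definition wpair u v (i : bool) : wfun M := if i then u else v.

Lemma form_wpair (c : bool -> R) u v w :
  F (wsum c (wpair u v)) w = c true * F u w + c false * F v w.
Proof. by rewrite /F wgform_suml big_bool. Qed.

Variables g1 g2 : 'rV[R]_d -> R.

Lemma Pol_edge_proj j e g : Pol j (edge_proj j e g).
Proof.
by rewrite /edge_proj; case: xgetP => [q _ []//|_]; exact: Pol0.
Qed.

(** The third component is taken along the outward normal of the cell, a unit vector, so that its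
    normal component is exactly [Qn m e g2]. *)
Definition dirichlet_lift : wfun M :=
  WFun (fun=> 0) (fun T e => if on_G1 G1 e then Qb m e g1 else 0)
    (fun T e i => if on_G1 G1 e then cell_normal T e 0 i *: Qn m e g2 else 0).

Lemma dirichlet_lift_G1 T e : eset e `<=` G1 ->
  wb dirichlet_lift T e = Qb m e g1 /\
  ncomp (cell_normal T e) (wg dirichlet_lift T e) = Qn m e g2.
Proof.
move=> /asboolP eG; rewrite /= /on_G1 eG; split => //.
by rewrite ncomp_scale//; exact: cell_normal_unit.
Qed.

(** An edge inside [G1] lies on the boundary of [Omega], so on interior edges the lift is zero and
    thus single-valued. *)
Lemma dirichlet_lift_W : in_W m dirichlet_lift.
Proof.
split.
  move=> T; split; first exact: Pol0.
  move=> e Te; split => [|i] /=; case: ifP => _; try exact: Pol0.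
    exact: Pol_edge_proj.
  by apply: PolZ; exact: Pol_edge_proj.
move=> e ie T T' _ _ /=; have [/asboolP eG|_] := boolP (on_G1 G1 e); last by [].
by case: ie => x /eG /hG1.
Qed.

Lemma lswg_exists : exists u, lswg_solution m k G1 f g1 g2 u.
Proof.
have [v [[Wv v0] Hv]] := variational_exists dirichlet_lift.
exists (wsum (fun=> 1) (wpair dirichlet_lift v)); split.
- by apply: in_W_sum => -[]; [exact: dirichlet_lift_W|exact: Wv].
- move=> T e Te eG; have [E1 E2] := v0 T e Te eG.
  have [D1 D2] := dirichlet_lift_G1 T eG.
  by rewrite /= ncomp_sum !big_bool /wpair !scale1r D1 D2 E1 E2 /= !addr0.
- by move=> w Ww; rewrite -/(F _ _) form_wpair !mul1r; exact: Hv.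
Qed.

(** The difference has zero data on [G1], so it is itself an admissible test function, and the form
    of it against every test function is zero. *)
Lemma lswg_unique u u' : lswg_solution m k G1 f g1 g2 u ->
  lswg_solution m k G1 f g1 g2 u' -> weq u' u.
Proof.
move=> [Wu gu Hu] [Wu' gu' Hu'].
pose c (i : bool) : R := if i then 1 else -1.
have We : in_W0 m G1 (wsum c (wpair u' u)).
  split; first by apply: in_W_sum => -[].
  move=> T e Te eG; have [E1 E2] := gu T e Te eG; have [D1 D2] := gu' T e Te eG.
  by rewrite /= ncomp_sum !big_bool /wpair /c !scale1r !scaleN1r E1 E2 D1 D2 /= !subrr.
have e0 : weq (wsum c (wpair u' u)) zero.
  apply: variational_unique => // w Ww; rewrite form_wpair mul1r mulN1r.
  by rewrite /F Hu// Hu'// subrr.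
have sub0 (V : zmodType) (x y : V) : x - y = 0 -> x = y.
  by move/eqP; rewrite subr_eq0 => /eqP.
move=> T; have [E0 E] := e0 T; split.
  by move: E0; rewrite /= big_bool big_ord0 /= scale1r scaleN1r => /sub0.
move=> e /E; rewrite /= !ncomp_sum !big_bool !big_ord0 /= !scale1r !scaleN1r.
by move=> [/sub0 -> /sub0 ->].
Qed.

End existence.

Theorem lemma4p2 (R : realType) (d : nat) (hd : d = 2%N \/ d = 3%N)
    (Omega Gamma1 Gamma2 : set 'rV[R]_d)
    (hOmega : polytopal Omega)
    (hGamma : boundary_partition Omega Gamma1 Gamma2)
    (hGamma1 : pos_surface Gamma1)
    (M : mesh Omega) (rho gamma : R) (N : nat)
    (hM : shape_regular M rho gamma N)
    (m : nat) (hm : (1 <= m)%N) (k : R) (hk : 0 < k)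
    (f g1 g2 : 'rV[R]_d -> R)
    (hf : L2 Omega f) (hg1 : L2_surface Gamma1 g1) (hg2 : L2_surface Gamma1 g2)
    (hcauchy : cauchy_unique_solution Omega Gamma1 k f g1 g2) :
  exists2 u : wfun M,
    lswg_solution m k Gamma1 f g1 g2 u &
    forall u' : wfun M, lswg_solution m k Gamma1 f g1 g2 u' -> weq u' u.
Proof.
have G1b : Gamma1 `<=` bdry Omega.
  by have [U _ ->] := bpart_open1 hGamma; exact: subIsetl.
have [u Hu] := lswg_exists hd M m hk hOmega hf G1b g1 g2.
by exists u => // u'; exact: lswg_unique.
Qed.
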